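(* Let $h=h^{top}(\mathcal{H})$ be the topological entropy of the $\mathbb{Z}^2$ hard square shift $\mathcal{H}$. Then $h$ is computable in polynomial time; that is, there exists a polynomial $p(n)$ for which $h$ is computable in time $p(n)$.
   Context: Sites $u,v\in\mathbb{Z}^2$ are adjacent if $|u_1-v_1|+|u_2-v_2|=1$. The $\mathbb{Z}^2$ hard square shift $\mathcal{H}$ is the set of $x\in\{0,1\}^{\mathbb{Z}^2}$ such that no two adjacent sites both carry the letter $1$. Its topological entropy is $h^{top}(\mathcal{H})=\lim_{j_1,j_2\to\infty}\frac{\ln|L_{[1,j_1]\times[1,j_2]}(\mathcal{H})|}{j_1j_2}$ (the limit exists), where $[a,b]=\{a,\ldots,b\}$ and $L_S(\mathcal{H})$ is the set of configurations on $S$ that are restrictions of points of $\mathcal{H}$. A real number $\alpha$ is computable in time $f(n)$ if there exists a Turing machine which, on input $n$ (a positive integer), outputs a pair $(p_n,q_n)$ of integers such that $|\frac{p_n}{q_n}-\alpha|<\frac1n$, and this procedure takes less than $f(n)$ operations for every $n$. (The time bound is a function of the value $n$, where $1/n$ is the tolerance.) *)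

(* Defs.v *)
From HB Require Import structures.
From mathcomp Require Import all_boot all_order all_algebra finmap.
From mathcomp Require Import all_classical all_reals all_analysis.

Set Implicit Arguments.
Unset Strict Implicit.
Unset Printing Implicit Defensive.

Import Order.TTheory GRing.Theory Num.Theory.
Import numFieldNormedType.Exports.

Local Open Scope classical_set_scope.
Local Open Scope ring_scope.

Definition site : Type := (int * int)%type.

Definition adjacent_sites (u v : site) : bool :=
  `|u.1 - v.1| + `|u.2 - v.2| == 1 :> int.

(* The letters 0 and 1 are false and true. *)
Definition hard_square_shift : set (site -> bool) :=
  [set x | forall u v : site, adjacent_sites u v -> ~~ (x u && x v)].

(* The globally admissible patterns L_S(X). *)
Definition language (X : set (site -> bool)) (S : {fset int * int}) :
    {set {ffun S -> bool}} :=
  [set w : {ffun S -> bool} |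
    `[< exists2 x, X x & forall s : S, w s = x (val s) >]]%SET.

Definition rectangle (j1 j2 : nat) : {fset int * int} :=
  [fset (Posz a, Posz b) | a in iota 1 j1, b in iota 1 j2]%fset.

(* The limit is taken as j1 and j2 tend to infinity independently. *)
Definition topological_entropy (R : realType) (X : set (site -> bool)) : R :=
  lim ((fun j : nat * nat =>
          ln #|language X (rectangle j.1 j.2)|%:R / (j.1 * j.2)%:R : R)
       @ filter_prod \oo \oo).

Inductive symbol : Type := Bit of bool | Minus | Comma.

Inductive move : Type := MoveLeft | MoveStay | MoveRight.

(* Deterministic machines with ntapes.+1 two-way infinite tapes.  The
   domain of delta is finite, so delta is a finite table. *)
Record turing_machine : Type := TuringMachine {
  state : finType;
  alphabet : finType;
  ntapes : nat;
  blank : alphabet;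
  letter : symbol -> alphabet;
  letter_inj : injective letter;
  letter_neq_blank : forall s : symbol, letter s != blank;
  start : state;
  halting : pred state;
  delta : state -> {ffun 'I_ntapes.+1 -> alphabet} ->
          state * {ffun 'I_ntapes.+1 -> alphabet * move}
}.

Record configuration (M : turing_machine) : Type := Configuration {
  current : state M;
  head_pos : 'I_(ntapes M).+1 -> int;
  tape : 'I_(ntapes M).+1 -> int -> alphabet M
}.

Definition move_head (m : move) (z : int) : int :=
  match m with
  | MoveLeft => z - 1
  | MoveStay => z
  | MoveRight => z + 1
  end.

Definition step (M : turing_machine) (c : configuration M) : configuration M :=
  if halting (current c) then c else
  let d := delta (current c) [ffun i => tape c i (head_pos c i)] in
  Configuration d.1
    (fun i => move_head (d.2 i).2 (head_pos c i))
    (fun i z => if z == head_pos c i then (d.2 i).1 else tape c i z).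

(* The tape carrying the word w on the cells 0, 1, ..., size w - 1. *)
Definition word_tape (M : turing_machine) (w : seq symbol) (z : int) :
    alphabet M :=
  if z is Posz i then nth (blank M) (map (@letter M) w) i else blank M.

Definition initial (M : turing_machine) (w : seq symbol) : configuration M :=
  Configuration (start M) (fun=> 0)
    (fun i => if i == ord0 then word_tape M w else word_tape M [::]).

(* Within t steps, M halts on the input w (on the first tape) with the output
   w' alone on the last tape; the other tapes may hold anything. *)
Definition outputs_within (M : turing_machine) (w w' : seq symbol) (t : nat) :
    Prop :=
  let c := iter t (@step M) (initial M w) in
  halting (current c) /\ tape c ord_max =1 word_tape M w'.

(* Binary digits, most significant first, without leading zeros ("0" for 0). *)
Definition encode_nat (n : nat) : seq symbol :=
  [seq Bit (odd (n %/ 2 ^ i)) | i <- rev (iota 0 (trunc_log 2 n).+1)]%N.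

Definition encode_int (z : int) : seq symbol :=
  if z < 0 then Minus :: encode_nat `|z|%N else encode_nat `|z|%N.

Definition encode_pair (p q : int) : seq symbol :=
  encode_int p ++ Comma :: encode_int q.

(* The condition q != 0 is needed because division by zero is total here. *)
Definition computable_in_time (R : realType) (alpha : R) (f : nat -> R) :
    Prop :=
  exists M : turing_machine, forall n : nat, (0 < n)%N ->
    exists p q : int,
      [/\ q != 0,
          `|p%:~R / q%:~R - alpha| < n%:R^-1 &
          exists2 t : nat,
            t%:R < f n & outputs_within M (encode_nat n) (encode_pair p q) t].

(* Main.v *)
Require Import Defs.
From mathcomp Require Import all_boot all_order all_algebra finmap.
From mathcomp Require Import all_classical all_reals all_analysis.
From mathcomp Require Import zify ring lra.

(* Deleting vertices one at a time expresses the number of independent sets of a rectangle as a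
   product of inverse vacancy probabilities, each of a site in the graph where the
   lexicographically smaller sites are deleted. Weitz's recursion writes such a probability as
   [1 / (1 + x0 x1 x2 x3)], where the [xi] are vacancy probabilities of the neighbours in smaller
   graphs. At activity 1 on a graph where one neighbour is always gone, two levels of the recursion
   contract ratios by a factor 9/10, so truncating it at depth [d] costs an error exponentially
   small in [d], uniformly over the sites at distance more than [d] from the boundary. Hence the
   entropy is within [(9/10)^e] of [- ln] of the value at the root of an explicit tree of depth
   [2 e] whose leaves have value 1. For accuracy [1/n] the depth is logarithmic in [n] and the tree
   has polynomially many nodes; fixed-point evaluation in a table indexed by the base-4 path,
   followed by [ln (m / a) ~ sum_(a <= k < m) 1 / k], only handles numbers polynomial in [n].
   A machine whose registers are unary counters therefore runs in polynomial time. *)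

Set Implicit Arguments.
Unset Strict Implicit.
Unset Printing Implicit Defensive.

Import Order.TTheory GRing.Theory Num.Theory.
Import numFieldNormedType.Exports.

(** * Turing machines from structured programs *)

Local Open Scope nat_scope.

(** Below the root of the tree a site lacks its parent, and the scanned site lacks its left
    neighbour, so every product has at most three live factors. One level still need not contract:
    [ln (1 / (1 + x0 x1 x2 x3))] has derivative [- (1 - y)] in each [ln xi], where [1 - y] is the
    occupation probability of the parent. That probability may be close to 1/2, and three live
    factors then give about 3/2. But children that are often occupied make the product at their
    parent small, and two levels exploit this trade-off; the bound for the lower level therefore
    keeps the weight [1 - y]. For infinitesimal errors two levels give a factor just under 0.7. The
    value 9/10 leaves room for finite ratios up to 2, where the induction starts, since all
    vacancies lie in [1/2, 1].

    The estimate is uniform over rectangles, so it also makes the normalised logarithms Cauchy: the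
    limit exists without any appeal to subadditivity. Rounding errors at most quadruple per level,
    plus one unit, so at logarithmic depth a denominator polynomial in [n] absorbs them. *)

Definition cell : finType := option (bool + bool).

Definition cell_of (s : symbol) : cell :=
  match s with
  | Bit b => Some (inl b)
  | Minus => Some (inr false)
  | Comma => Some (inr true)
  end.

Lemma cell_of_inj : injective cell_of.
Proof. by case=> [[]||] [[]||]. Qed.

Lemma cell_of_neq_blank (s : symbol) : cell_of s != None.
Proof. by case: s. Qed.

Definition tape_state : Type := int * (int -> cell).

Definition action : Type := cell -> cell * move.

Definition act (g : action) (t : tape_state) : tape_state :=
  (move_head (g (t.2 t.1)).2 t.1,
   fun z => if z == t.1 then (g (t.2 t.1)).1 else t.2 z).

Definition idle : action := fun x => (x, MoveStay).

Lemma act_idle (t : tape_state) : act idle t = t.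
Proof.
case: t => h f; rewrite /act /=; congr pair.
by apply: funext => z; case: eqP => // ->.
Qed.

Definition upd (A : Type) (c : nat -> A) (i : nat) (x : A) : nat -> A :=
  fun k => if k == i then x else c k.

Lemma upd_id (A : Type) (c : nat -> A) (i : nat) : upd c i (c i) = c.
Proof. by apply: funext => k; rewrite /upd; case: eqP => // ->. Qed.

Inductive tprog : Type :=
  | Act of nat & action
  | Seq of tprog & tprog
  | If of nat & pred cell & tprog & tprog
  | While of nat & pred cell & tprog.

Definition scanned (c : nat -> tape_state) (k : nat) : cell := (c k).2 (c k).1.

(** Exact step counts. A test costs one step because the compiled machine spends a state of its own
    on it, leaving the tapes as they are. *)
Inductive run : tprog -> (nat -> tape_state) -> nat -> (nat -> tape_state) -> Prop :=
  | RunAct i g c : run (Act i g) c 1 (upd c i (act g (c i)))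
  | RunSeq p q c t c' t' c'' :
      run p c t c' -> run q c' t' c'' -> run (Seq p q) c (t + t') c''
  | RunIfTrue i (a : pred cell) p q c t c' :
      a (scanned c i) -> run p c t c' -> run (If i a p q) c t.+1 c'
  | RunIfFalse i (a : pred cell) p q c t c' :
      ~~ a (scanned c i) -> run q c t c' -> run (If i a p q) c t.+1 c'
  | RunWhileFalse i (a : pred cell) p c : ~~ a (scanned c i) -> run (While i a p) c 1 c
  | RunWhileTrue i (a : pred cell) p c t c' t' c'' :
      a (scanned c i) -> run p c t c' -> run (While i a p) c' t' c'' ->
      run (While i a p) c (t + t').+1 c''.

Fixpoint tprog_state (p : tprog) : finType :=
  match p with
  | Act _ _ => unit
  | Seq p q => (tprog_state p + tprog_state q)%type
  | If _ _ p q => option (tprog_state p + tprog_state q)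
  | While _ _ p => option (tprog_state p)
  end.

Fixpoint tprog_start (p : tprog) : tprog_state p :=
  match p with
  | Act _ _ => tt
  | Seq p q => inl (tprog_start p)
  | If _ _ p q => None
  | While _ _ p => None
  end.

Definition idle_act : nat * action := (0, idle).

(* The next state [None] means that control leaves the program. *)
Fixpoint tprog_delta (p : tprog) :
    tprog_state p -> (nat -> cell) -> option (tprog_state p) * (nat * action) :=
  match p with
  | Act i g => fun _ _ => (None, (i, g))
  | Seq p q => fun s r =>
      match s with
      | inl s => let d := tprog_delta s r in
                 (Some (if d.1 is Some s' then inl s' else inr (tprog_start q)), d.2)
      | inr s => let d := tprog_delta s r in (omap inr d.1, d.2)
      end
  | If i a p q => fun s r =>
      match s with
      | None => (Some (Some (if a (r i) then inl (tprog_start p)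
                             else inr (tprog_start q))), idle_act)
      | Some (inl s) =>
          let d := tprog_delta s r in (omap (Some \o inl) d.1, d.2)
      | Some (inr s) =>
          let d := tprog_delta s r in (omap (Some \o inr) d.1, d.2)
      end
  | While i a p => fun s r =>
      match s with
      | None => (if a (r i) then Some (Some (tprog_start p)) else None, idle_act)
      | Some s => let d := tprog_delta s r in (Some d.1, d.2)
      end
  end.

Definition act_on (c : nat -> tape_state) (m : nat * action) : nat -> tape_state :=
  upd c m.1 (act m.2 (c m.1)).

Lemma act_on_idle (c : nat -> tape_state) : act_on c idle_act = c.
Proof. by rewrite /act_on act_idle upd_id. Qed.

(** Small-step counterpart of [run], stated for an arbitrary inner state so that an enclosing
    construct can redirect the moment when control leaves [p]. *)
Inductive exits (p : tprog) :
    tprog_state p -> (nat -> tape_state) -> nat -> (nat -> tape_state) -> Prop :=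
  | ExitNow s c m : tprog_delta s (scanned c) = (None, m) ->
      exits s c 1 (act_on c m)
  | ExitLater s c s' m t c' : tprog_delta s (scanned c) = (Some s', m) ->
      exits s' (act_on c m) t c' -> exits s c t.+1 c'.

Lemma exits_seqr (p q : tprog) (s : tprog_state q) c t c' :
  exits s c t c' -> @exits (Seq p q) (inr s) c t c'.
Proof.
elim=> {s c t c'} [s c m E|s c s' m t c' E _ IH].
  by apply: ExitNow; rewrite /= E.
by apply: (@ExitLater (Seq p q) _ _ (inr s') m); rewrite /= ?E //.
Qed.

Lemma exits_seq (p q : tprog) (s : tprog_state p) c t c' t' c'' :
  exits s c t c' -> exits (tprog_start q) c' t' c'' ->
  @exits (Seq p q) (inl s) c (t + t') c''.
Proof.
move=> H Hq; elim: H Hq => {s c t c'} [s c m E|s c s' m t c' E _ IH] Hq.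
  by rewrite add1n; apply: (@ExitLater (Seq p q) _ _ (inr (tprog_start q)) m);
    rewrite /= ?E //; exact: exits_seqr.
by rewrite addSn; apply: (@ExitLater (Seq p q) _ _ (inl s') m); rewrite /= ?E //;
  exact: IH.
Qed.

Lemma exits_ifl i a (p q : tprog) (s : tprog_state p) c t c' :
  exits s c t c' -> @exits (If i a p q) (Some (inl s)) c t c'.
Proof.
elim=> {s c t c'} [s c m E|s c s' m t c' E _ IH].
  by apply: ExitNow; rewrite /= E.
by apply: (@ExitLater (If i a p q) _ _ (Some (inl s')) m); rewrite /= ?E //.
Qed.

Lemma exits_ifr i a (p q : tprog) (s : tprog_state q) c t c' :
  exits s c t c' -> @exits (If i a p q) (Some (inr s)) c t c'.
Proof.
elim=> {s c t c'} [s c m E|s c s' m t c' E _ IH].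
  by apply: ExitNow; rewrite /= E.
by apply: (@ExitLater (If i a p q) _ _ (Some (inr s')) m); rewrite /= ?E //.
Qed.

Lemma exits_while i a (p : tprog) (s : tprog_state p) c t c' t' c'' :
  exits s c t c' -> @exits (While i a p) None c' t' c'' ->
  @exits (While i a p) (Some s) c (t + t') c''.
Proof.
move=> H Hq; elim: H Hq => {s c t c'} [s c m E|s c s' m t c' E _ IH] Hq.
  by rewrite add1n; apply: (@ExitLater (While i a p) _ _ None m); rewrite /= ?E.
by rewrite addSn; apply: (@ExitLater (While i a p) _ _ (Some s') m);
  rewrite /= ?E //; exact: IH.
Qed.

Lemma run_exits (p : tprog) c t c' : run p c t c' -> exits (tprog_start p) c t c'.
Proof.
elim=> {p c t c'}
  [i g c|p q c t c' t' c'' _ Hp _ Hq|i a p q c t c' ha _ IH|i a p q c t c' ha _ IH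
  |i a p c ha|i a p c t c' t' c'' ha _ IH _ IHw].
- exact: (@ExitNow (Act i g) tt c (i, g)).
- exact: exits_seq Hp Hq.
- apply: (@ExitLater (If i a p q) _ _ (Some (inl (tprog_start p))) idle_act).
    by rewrite /= ha.
  by rewrite act_on_idle; exact: exits_ifl.
- apply: (@ExitLater (If i a p q) _ _ (Some (inr (tprog_start q))) idle_act).
    by rewrite /= (negbTE ha).
  by rewrite act_on_idle; exact: exits_ifr.
- rewrite -{2}(act_on_idle c); apply: (@ExitNow (While i a p) None c idle_act).
  by rewrite /= (negbTE ha).
- apply: (@ExitLater (While i a p) _ _ (Some (tprog_start p)) idle_act).
    by rewrite /= ha.
  by rewrite act_on_idle; exact: exits_while IH IHw.
Qed.

Fixpoint max_tape (p : tprog) : nat :=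
  match p with
  | Act i _ => i
  | Seq p q => maxn (max_tape p) (max_tape q)
  | If i _ p q => maxn i (maxn (max_tape p) (max_tape q))
  | While i _ p => maxn i (max_tape p)
  end.

Lemma tprog_delta_tape (p : tprog) (s : tprog_state p) r :
  (tprog_delta s r).2.1 <= max_tape p.
Proof.
elim: p s r => [i g|p IHp q IHq|i a p IHp q IHq|i a p IHp] //=.
- by case=> s r /=; [have := IHp s r|have := IHq s r]; lia.
- by case=> [[] s|] r //=; [have := IHp s r|have := IHq s r]; lia.
- by case=> [s|] r //=; have := IHp s r; lia.
Qed.

(** Programs see infinitely many tapes and machines finitely many; the two agree because only tapes
    up to [max_tape p] are consulted. *)
Lemma tprog_delta_ext (p : tprog) (s : tprog_state p) r r' :
  (forall k, k <= max_tape p -> r k = r' k) ->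
  tprog_delta s r = tprog_delta s r'.
Proof.
elim: p s => [i g|p IHp q IHq|i a p IHp q IHq|i a p IHp] //= s H.
- by case: s => s /=; rewrite (IHp, IHq) // => k hk; apply: H; lia.
- case: s => [[] s|] /=; try by rewrite (IHp, IHq) // => k hk; apply: H; lia.
  by rewrite H //; lia.
- case: s => [s|] /=; first by rewrite IHp // => k hk; apply: H; lia.
  by rewrite H //; lia.
Qed.

Lemma configuration_ext (M : turing_machine) (s : state M)
    (h h' : 'I_(ntapes M).+1 -> int) (f f' : 'I_(ntapes M).+1 -> int -> alphabet M) :
  h =1 h' -> (forall i, f i =1 f' i) -> Configuration s h f = Configuration s h' f'.
Proof.
move=> hh hf; have -> : h = h' by apply: funext.
by suff -> : f = f' by []; apply: funext => i; apply: funext => z; apply: hf.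
Qed.

Section Compile.
Variables (p : tprog) (K : nat).

(* Tape 1 of a program is the output tape, which the machine model wants last. *)
Definition tape_index (i : 'I_K.+3) : nat :=
  if i == ord_max then 1 else if i == 0 :> nat then 0 else i.+1.

Definition tape_ord (k : nat) : 'I_K.+3 :=
  if k == 1 then ord_max else if k == 0 then ord0 else inord k.-1.

Lemma tape_ordK (k : nat) : k < K.+3 -> tape_index (tape_ord k) = k.
Proof.
move=> hk; rewrite /tape_index /tape_ord.
case: (k =P 1) => [->|k1]; first by rewrite eqxx.
case: (k =P 0) => [->|k0]; first by [].
rewrite -val_eqE /= inordK; last by lia.
by rewrite !ifF; lia.
Qed.

Definition machine_delta (s : option (tprog_state p))
    (r : {ffun 'I_K.+3 -> cell}) :
    option (tprog_state p) * {ffun 'I_K.+3 -> cell * move} :=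
  match s with
  | None => (None, [ffun i => (r i, MoveStay)])
  | Some s =>
      let d := tprog_delta s (fun k => r (tape_ord k)) in
      (d.1, [ffun i => if tape_index i == d.2.1 then d.2.2 (r i)
                       else (r i, MoveStay)])
  end.

Definition machine : turing_machine :=
  @TuringMachine (option (tprog_state p)) cell K.+2 None cell_of cell_of_inj
    cell_of_neq_blank (Some (tprog_start p)) (fun s => s == None) machine_delta.

Definition machine_conf (s : option (tprog_state p)) (c : nat -> tape_state) :
    configuration machine :=
  @Configuration machine s (fun i => (c (tape_index i)).1)
    (fun i => (c (tape_index i)).2).

Hypothesis bounded_tapes : max_tape p < K.+3.

Lemma step_machine_conf (s : tprog_state p) (c : nat -> tape_state) :
  step (machine_conf (Some s) c) =
  let d := tprog_delta s (scanned c) in machine_conf d.1 (act_on c d.2).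
Proof.
rewrite /step /=.
rewrite (@tprog_delta_ext p s _ (scanned c)); last first.
  by move=> k hk; rewrite ffunE /= tape_ordK //; lia.
have := tprog_delta_tape s (scanned c).
case: (tprog_delta s (scanned c)) => s' [k g] /= hk.
apply: configuration_ext => [i|i z]; rewrite !ffunE /act_on /upd /=.
  by case: eqP => // <-.
by case: (tape_index i =P k) => [<-|_] //=; case: (z =P _) => // ->.
Qed.

Lemma iter_step_exits (s : tprog_state p) c t c' :
  exits s c t c' -> iter t (@step machine) (machine_conf (Some s) c) =
                    machine_conf None c'.
Proof.
elim=> {s c t c'} [s c m E|s c s' m t c' E _ IH].
  by rewrite /= step_machine_conf E.
by rewrite iterSr step_machine_conf E /=.
Qed.

End Compile.

Definition word_cells (w : seq cell) (z : int) : cell :=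
  if z is Posz i then nth None w i else None.

Definition start_conf (w : seq symbol) : nat -> tape_state :=
  upd (fun=> (0%R, word_cells [::])) 0 (0%R, word_cells (map cell_of w)).

Lemma run_outputs (p : tprog) (w w' : seq symbol) (t : nat)
    (c' : nat -> tape_state) :
  run p (start_conf w) t c' -> (c' 1).2 = word_cells (map cell_of w') ->
  outputs_within (machine p (max_tape p)) w w' t.
Proof.
move=> /run_exits hr hc.
have hK : max_tape p < (max_tape p).+3 by lia.
rewrite /outputs_within.
have -> : initial (machine p (max_tape p)) w =
    machine_conf (max_tape p) (Some (tprog_start p)) (start_conf w).
  apply: configuration_ext => [i|i z]; rewrite /start_conf /upd /tape_index.
    by do ! case: ifP => //.
  rewrite -!val_eqE /=; case: (i =P 0 :> nat) => [->|_] /=; first by case: z.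
  by case: (nat_of_ord i == _); case: z.
rewrite (iter_step_exits hK hr) /=; split => // z.
by rewrite /tape_index eqxx hc.
Qed.

(** * Unary registers *)

Definition mark : cell := Some (inl true).
Definition comma : cell := Some (inr true).

(** The head rests on the last mark, and on the blank cell 0 when [v] is 0. Testing for zero thus
    means reading one cell, and incrementing or decrementing takes a constant number of steps. *)
Definition reg_tape (v : nat) : tape_state :=
  (Posz v, fun z : int => if z is Posz n then
                            if 0 < n <= v then mark else None
                          else None).

Definition conf (tin tout tarr : tape_state) (f : nat -> nat) (i : nat) : tape_state :=
  match i with
  | 0 => tin
  | 1 => tout
  | 2 => tarr
  | r.+3 => reg_tape (f r)
  end.

Definition runs (p : tprog) (c : nat -> tape_state) (b : nat) (c' : nat -> tape_state) :=
  exists2 t, t <= b & run p c t c'.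

Lemma runs_le p c b b' c' : b <= b' -> runs p c b c' -> runs p c b' c'.
Proof. by move=> hb [t ht hr]; exists t => //; lia. Qed.

Lemma runs_act i g c : runs (Act i g) c 1 (upd c i (act g (c i))).
Proof. by exists 1 => //; apply: RunAct. Qed.

Lemma runs_seq p q c b c' b' c'' :
  runs p c b c' -> runs q c' b' c'' -> runs (Seq p q) c (b + b') c''.
Proof.
by move=> [t ht hr] [t' ht' hr']; exists (t + t'); [lia|exact: RunSeq hr hr'].
Qed.

Lemma runs_if i (a : pred cell) p q c b c' :
  (a (scanned c i) -> runs p c b c') -> (~~ a (scanned c i) -> runs q c b c') ->
  runs (If i a p q) c b.+1 c'.
Proof.
case: (boolP (a (scanned c i))) => ha Hp Hq.
  by have [t ht hr] := Hp isT; exists t.+1 => //; exact: RunIfTrue.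
by have [t ht hr] := Hq isT; exists t.+1 => //; exact: RunIfFalse.
Qed.

(** The intermediate configurations are indexed by the number of iterations still to come, which for
    a counting loop is the value of its counter. *)
Lemma runs_while i (a : pred cell) p (c : nat -> nat -> tape_state) b n :
  ~~ a (scanned (c 0) i) ->
  (forall k, k < n -> a (scanned (c k.+1) i) /\ runs p (c k.+1) b (c k)) ->
  runs (While i a p) (c n) (n * b.+1).+1 (c 0).
Proof.
move=> h0; elim: n => [|n IH] H; first by exists 1 => //; exact: RunWhileFalse.
have [ha [t ht hr]] := H n (leqnn _).
have [|t' ht' hr'] := IH; first by move=> k hk; apply: H; lia.
by exists (t + t').+1; [rewrite mulSn; lia|exact: RunWhileTrue ha hr hr'].
Qed.

Lemma conf_eq tin tout tarr f f' :
  f =1 f' -> conf tin tout tarr f = conf tin tout tarr f'.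
Proof. by move=> /funext ->. Qed.

Lemma upd_conf_reg tin tout tarr f r v :
  upd (conf tin tout tarr f) r.+3 (reg_tape v) = conf tin tout tarr (upd f r v).
Proof.
by apply: funext => [[|[|[|k]]]]; rewrite /upd //= !eqSS; case: eqP.
Qed.

Lemma upd_conf_arr tin tout tarr f t :
  upd (conf tin tout tarr f) 2 t = conf tin tout t f.
Proof. by apply: funext => [[|[|[|k]]]]. Qed.

Lemma upd_conf_in tin tout tarr f t :
  upd (conf tin tout tarr f) 0 t = conf t tout tarr f.
Proof. by apply: funext => [[|[|[|k]]]]. Qed.

Lemma upd_conf_out tin tout tarr f t :
  upd (conf tin tout tarr f) 1 t = conf tin t tarr f.
Proof. by apply: funext => [[|[|[|k]]]]. Qed.

Lemma scanned_reg tin tout tarr f r :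
  isSome (scanned (conf tin tout tarr f) r.+3) = (0 < f r).
Proof. by rewrite /scanned /=; case: (f r) => [|n] //=; rewrite leqnn. Qed.

Definition inc (r : nat) : tprog :=
  Seq (Act r.+3 (fun x => (x, MoveRight))) (Act r.+3 (fun x => (mark, MoveStay))).

Definition dec (r : nat) : tprog := Act r.+3 (fun x => (None, MoveLeft)).

Definition while_pos (r : nat) (p : tprog) : tprog :=
  While r.+3 (fun x => isSome x) p.

Definition clear (r : nat) : tprog := while_pos r (dec r).

Definition transfer (r s : nat) : tprog := while_pos r (Seq (dec r) (inc s)).

(** A unary register is read by emptying it, hence the scratch register [t], from which [r] is
    restored. *)
Definition copy (r s t : nat) : tprog :=
  Seq (while_pos r (Seq (dec r) (Seq (inc s) (inc t)))) (transfer t r).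

Section Registers.
Variables (tin tout tarr : tape_state).
Local Notation conf := (conf tin tout tarr).

Lemma runs_inc f r : runs (inc r) (conf f) 2 (conf (upd f r (f r).+1)).
Proof.
have h := runs_seq (runs_act r.+3 (fun x => (x, MoveRight)) (conf f))
  (runs_act r.+3 (fun x => (mark, MoveStay)) _).
apply: eq_ind (h) _ _; rewrite -upd_conf_reg; apply: funext => k.
rewrite /upd eqxx /=; case: (k =P r.+3) => // _.
rewrite /act /= /reg_tape; congr pair; first by rewrite -addn1 PoszD.
apply: funext => z.
have -> : (Posz (f r) + 1 = Posz (f r).+1)%R by rewrite -addn1 PoszD.
case: (z =P _) => [->|hz] //=; first by rewrite leqnn.
case: z hz => // n hn.
have <- : (0 < n <= f r) = (0 < n <= (f r).+1) by apply/idP/idP => ?; lia.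
by case: eqP => // -[->].
Qed.

Lemma runs_dec f r : 0 < f r -> runs (dec r) (conf f) 1 (conf (upd f r (f r).-1)).
Proof.
move=> hf; have h := runs_act r.+3 (fun x => (None : cell, MoveLeft)) (conf f).
apply: eq_ind (h) _ _; rewrite -upd_conf_reg; congr upd.
rewrite /act /= /reg_tape; congr pair; first by lia.
apply: funext => z; case: (z =P _) => [->|hz] //=; first by case: ifP => //; lia.
case: z hz => // n hn.
by have -> : (0 < n <= f r) = (0 < n <= (f r).-1) by apply/idP/idP => ?; lia.
Qed.

Lemma runs_while_pos r p b n (F : nat -> nat -> nat) :
  (forall k, k <= n -> F k r = k) ->
  (forall k, k < n -> runs p (conf (F k.+1)) b (conf (F k))) ->
  runs (while_pos r p) (conf (F n)) (n * b.+1).+1 (conf (F 0)).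
Proof.
move=> Fr H; apply: (@runs_while _ _ _ (fun k => conf (F k))).
  by rewrite scanned_reg Fr.
by move=> k hk; split; [rewrite scanned_reg Fr|exact: H].
Qed.

Ltac upd_solve :=
  apply: conf_eq => ?; rewrite /upd /=;
  repeat (case: eqP => //= ?); subst; lia.

Lemma runs_clear f r : runs (clear r) (conf f) (2 * f r).+1 (conf (upd f r 0)).
Proof.
have := @runs_while_pos r (dec r) 1 (f r) (fun k => upd f r k).
rewrite upd_id mulnC; apply => [k _|k hk]; first by rewrite /upd eqxx.
have := @runs_dec (upd f r k.+1) r; rewrite /upd eqxx => /(_ isT).
congr (runs _ _ _ _); upd_solve.
Qed.

Lemma runs_transfer f r s : r != s ->
  runs (transfer r s) (conf f) (4 * f r).+1 (conf (upd (upd f r 0) s (f s + f r))).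
Proof.
move=> /eqP hrs.
have := @runs_while_pos r (Seq (dec r) (inc s)) 3 (f r)
  (fun k => upd (upd f r k) s (f s + (f r - k))).
rewrite subnn addn0 subn0 mulnC.
have -> : upd (upd f r (f r)) s (f s) = f by rewrite upd_id upd_id.
apply => [k _|k hk]; first by rewrite /upd eqxx; case: eqP.
apply: (@runs_seq _ _ _ 1 _ 2); first by apply: runs_dec; rewrite /upd eqxx; case: eqP.
have := @runs_inc (upd (upd f r k) s (f s + (f r - k.+1))) s.
congr (runs _ _ _ _); upd_solve.
Qed.

Lemma runs_copy f r s t : r != s -> r != t -> s != t -> f s = 0 -> f t = 0 ->
  runs (copy r s t) (conf f) (10 * f r + 2) (conf (upd f s (f r))).
Proof.
move=> /eqP hrs /eqP hrt /eqP hst fs ft.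
have hdrs : (r == s) = false by apply/eqP.
have hdrt : (r == t) = false by apply/eqP.
have hdst : (s == t) = false by apply/eqP.
have -> : 10 * f r + 2 = (f r * 6).+1 + (4 * f r).+1 by lia.
apply: (@runs_seq _ _ _ _ (conf (upd (upd (upd f r 0) s (f r)) t (f r)))).
  have := @runs_while_pos r (Seq (dec r) (Seq (inc s) (inc t))) 5 (f r)
    (fun k => upd (upd (upd f r k) s (f r - k)) t (f r - k)).
  rewrite subnn subn0.
  have -> : upd (upd (upd f r (f r)) s 0) t 0 = f.
    by apply: funext => k; rewrite /upd; repeat (case: eqP => //= ?); subst.
  apply => [k _|k hk]; first by rewrite /upd eqxx hdrs hdrt.
  apply: (@runs_seq _ _ _ 1 _ 4).
    by apply: runs_dec; rewrite /upd eqxx hdrs hdrt.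
  apply: (@runs_seq _ _ _ 2 _ 2); first exact: runs_inc.
  have := @runs_inc (upd (upd (upd f r k) s (f r - k)) t (f r - k.+1)) t.
  congr (runs _ _ _ _); upd_solve.
set g := upd (upd (upd f r 0) s (f r)) t (f r).
have gt : g t = f r by rewrite /g /upd eqxx.
have := @runs_transfer g t r; rewrite gt eq_sym hdrt => /(_ isT).
congr (runs _ _ _ _); rewrite /g; upd_solve.
Qed.

End Registers.

(** * A list of numbers on one tape *)

Fixpoint table_word (a : seq nat) : seq cell :=
  if a is v :: a' then table_word a' ++ comma :: nseq v mark else [::].

Definition end_tape (w : seq cell) : tape_state := (Posz (size w), word_cells w).

(** The head stands just right of the word. Since [table_word] lays the list out from right to left,
    adding an entry in front of the list appends it on the tape. *)
Definition table_tape (a : seq nat) : tape_state := end_tape (table_word a).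

Definition is_mark : pred cell := fun x => x == mark.

Definition go (i : nat) (m : move) : tprog := Act i (fun x => (x, m)).

Definition skip : tprog := Act 0 idle.

(* Marks are counted down in register [r], then counted up again on the entry reached. *)
Definition lookup (r : nat) : tprog :=
  Seq (go 2 MoveLeft)
 (Seq (while_pos r
        (Seq (dec r)
        (Seq (While 2 is_mark (go 2 MoveLeft))
             (If 2 (fun x => x == comma) (go 2 MoveLeft) skip))))
 (Seq (While 2 is_mark (Seq (go 2 MoveLeft) (inc r)))
 (Seq (go 2 MoveRight)
      (While 2 (fun x => isSome x) (go 2 MoveRight))))).

Lemma size_table_word (a : seq nat) : size (table_word a) = sumn a + size a.
Proof. by elim: a => //= v a IH; rewrite size_cat /= size_nseq IH; lia. Qed.

Lemma table_word_cat (a b : seq nat) :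
  table_word (a ++ b) = table_word b ++ table_word a.
Proof. by elim: a => [|v a IH] /=; rewrite ?cats0 // IH catA. Qed.

Lemma table_word_filled (a : seq nat) (i : nat) :
  i < size (table_word a) -> isSome (nth None (table_word a) i).
Proof.
move=> hi; have : all isSome (table_word a).
  by elim: a {i hi} => //= v a IH; rewrite all_cat IH /= all_nseq orbT.
by move/all_nthP; apply.
Qed.

Lemma runs_go c i m :
  runs (go i m) c 1 (upd c i (move_head m (c i).1, (c i).2)).
Proof.
have := runs_act i (fun x => (x, m)) c; rewrite /act /=.
congr (runs _ _ _ (upd _ _ (_, _))).
by apply: funext => z; case: eqP => // ->.
Qed.

Lemma runs_skip c : runs skip c 1 c.
Proof. by have := runs_act 0 idle c; rewrite act_idle upd_id. Qed.

Section Lookup.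
Variables (tin tout : tape_state) (a : seq nat).

Let w := table_word a.
Let conf_at (z : int) := conf tin tout (z, word_cells w).

Let runs_left z f : runs (go 2 MoveLeft) (conf_at z f) 1 (conf_at (z - 1)%R f).
Proof. by have := runs_go (conf_at z f) 2 MoveLeft; rewrite upd_conf_arr. Qed.

Let runs_right z f : runs (go 2 MoveRight) (conf_at z f) 1 (conf_at (z + 1)%R f).
Proof. by have := runs_go (conf_at z f) 2 MoveRight; rewrite upd_conf_arr. Qed.

(* The last cell of what remains of the word once the first [k] entries of [a] are passed. *)
Let pos (k : nat) : int := (Posz (size (table_word (drop k a))) - 1)%R.

Let word_at k v b : drop k a = v :: b ->
  (forall j, j <= v -> nth None w (size (table_word b) + j) =
     if j == 0 then comma else mark) /\ pos k = Posz (size (table_word b) + v).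
Proof.
move=> e; split; last by rewrite /pos e /= size_cat /= size_nseq; lia.
move=> j hj; rewrite /w -(cat_take_drop k a) table_word_cat e /=.
rewrite -catA nth_cat ltnNge leq_addr /= addKn.
by case: j hj => //= j hj; rewrite nth_cat size_nseq hj nth_nseq hj.
Qed.

(** Once all entries are passed, the head stays on the blank cell -1, so an index out of range
    yields 0, in agreement with the default of [nth]. *)
Let runs_skip_entry k f :
  runs (Seq (While 2 is_mark (go 2 MoveLeft))
            (If 2 (fun x => x == comma) (go 2 MoveLeft) skip))
    (conf_at (pos k) f) (2 * sumn a + 3) (conf_at (pos k.+1) f).
Proof.
case e : (drop k a) => [|v b].
  have -> : pos k.+1 = pos k.
    have hk : size a <= k by have := congr1 size e; rewrite size_drop /=; lia.
    by rewrite /pos !drop_oversize //; lia.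
  have hp : pos k = (-1)%R by rewrite /pos e.
  apply: (@runs_le _ _ (1 + 2)); first by lia.
  apply: (@runs_seq _ _ _ _ (conf_at (pos k) f)).
    by apply: (@runs_while _ _ _ (fun=> conf_at (pos k) f) 0 0); rewrite // hp.
  by apply: runs_if; rewrite hp // => _; exact: runs_skip.
have [hw hp] := word_at e.
have hv : v <= sumn a.
  by rewrite -(cat_take_drop k a) sumn_cat e /=; lia.
have -> : pos k.+1 = (Posz (size (table_word b) + 0) - 1)%R.
  by rewrite addn0 /pos -add1n -drop_drop e drop1.
apply: (@runs_le _ _ ((v * 2).+1 + 2)); first by lia.
rewrite hp; apply: (@runs_seq _ _ _ _ (conf_at (Posz (size (table_word b) + 0)) f)).
  apply: (@runs_while _ _ _ (fun j => conf_at (Posz (size (table_word b) + j)) f)).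
    by rewrite /scanned /= hw.
  move=> j hj; split; first by rewrite /scanned /= hw.
  have := runs_left (Posz (size (table_word b) + j.+1)) f.
  by congr (runs _ _ _ (conf_at _ f)); lia.
apply: runs_if; last by rewrite /scanned /= hw.
by move=> _; exact: runs_left.
Qed.

Let runs_count_entry k f r : f r = 0 ->
  runs (While 2 is_mark (Seq (go 2 MoveLeft) (inc r))) (conf_at (pos k) f)
    (4 * sumn a + 1) (conf_at (pos k - Posz (nth 0 a k))%R (upd f r (nth 0 a k))).
Proof.
move=> fr; case e : (drop k a) => [|v b].
  have -> : nth 0 a k = 0 by rewrite -[k]addn0 -nth_drop e nth_nil.
  rewrite -fr upd_id fr subr0.
  apply: (@runs_le _ _ 1); first by lia.
  apply: (@runs_while _ _ _ (fun=> conf_at (pos k) f) 0 0) => //.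
  by rewrite /scanned /= /pos e.
have -> : nth 0 a k = v by rewrite -[k]addn0 -nth_drop e.
have [hw hp] := word_at e.
have hv : v <= sumn a.
  by rewrite -(cat_take_drop k a) sumn_cat e /=; lia.
apply: (@runs_le _ _ ((v * 4).+1)); first by lia.
rewrite hp; set s := size _ in hw *.
have -> : (Posz (s + v) - Posz v)%R = Posz (s + 0) by lia.
have := @runs_while 2 is_mark (Seq (go 2 MoveLeft) (inc r))
  (fun j => conf_at (Posz (s + j)) (upd f r (v - j))) 3 v.
have fr0 : upd f r 0 = f by rewrite -fr upd_id.
rewrite subnn subn0 fr0; apply; first by rewrite /scanned /= hw.
move=> j hj; split; first by rewrite /scanned /= hw.
apply: (@runs_seq _ _ _ 1 _ 2); first exact: runs_left.
have := @runs_inc tin tout ((Posz (s + j.+1) - 1)%R, word_cells w) (upd f r (v - j.+1)) r.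
have -> : (Posz (s + j.+1) - 1)%R = Posz (s + j) by lia.
congr (runs _ _ _ _); apply: conf_eq => x; rewrite /upd eqxx.
by case: eqP => // _; lia.
Qed.

Let runs_rewind (z : int) f : (-1 <= z < Posz (size w))%R ->
  runs (Seq (go 2 MoveRight) (While 2 (fun x => isSome x) (go 2 MoveRight)))
    (conf_at z f) (2 * size w + 2) (conf_at (Posz (size w)) f).
Proof.
move=> hz; have [q hq] : exists q : nat, (z + 1 = Posz q :> int)%R.
  by exists `|(z + 1)%R|%N; lia.
apply: (@runs_le _ _ (1 + ((size w - q) * 2).+1)); first by lia.
apply: (@runs_seq _ _ _ _ (conf_at (Posz q) f)); first by rewrite -hq; exact: runs_right.
have hqw : q <= size w by lia.
have := @runs_while 2 (fun x => isSome x) (go 2 MoveRight)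
  (fun j => conf_at (Posz (size w - j)) f) 1 (size w - q).
rewrite subn0 subKn //; apply.
  by rewrite /scanned /= nth_default.
move=> j hj; split.
  have hs : size w - j.+1 < size w by lia.
  by rewrite /scanned /=; exact: table_word_filled.
have := runs_right (Posz (size w - j.+1)) f.
by congr (runs _ _ _ (conf_at _ f)); lia.
Qed.

Lemma runs_lookup f r :
  runs (lookup r) (conf tin tout (table_tape a) f)
    (f r * (2 * sumn a + 5) + 6 * (sumn a + size a) + 5)
    (conf tin tout (table_tape a) (upd f r (nth 0 a (f r)))).
Proof.
rewrite -[conf tin tout _ f]/(conf_at (Posz (size w)) f).
set x := f r.
apply: (@runs_le _ _ (1 + ((x * (2 * sumn a + 5)).+1 + ((4 * sumn a + 1) + (2 * size w + 2))))).
  by rewrite /w size_table_word; lia.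
apply: (runs_seq (runs_left _ _)).
have -> : (Posz (size w) - 1)%R = pos 0 by rewrite /pos drop0.
apply: (@runs_seq _ _ _ _ (conf_at (pos x) (upd f r 0))).
  have := @runs_while r.+3 (fun y => isSome y) (Seq (dec r)
      (Seq (While 2 is_mark (go 2 MoveLeft))
           (If 2 (fun y => y == comma) (go 2 MoveLeft) skip)))
    (fun j => conf_at (pos (x - j)) (upd f r j)) (2 * sumn a + 4) x.
  rewrite subn0 subnn upd_id -addnS; apply; first by rewrite scanned_reg /upd eqxx.
  move=> j hj; rewrite scanned_reg /upd eqxx; split => //; rewrite -!/(upd _ _ _).
  have -> : 2 * sumn a + 4 = 1 + (2 * sumn a + 3) by lia.
  apply: (@runs_seq _ _ _ _ (conf_at (pos (x - j.+1)) (upd f r j))).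
    have := @runs_dec tin tout (pos (x - j.+1), word_cells w) (upd f r j.+1) r.
    rewrite /upd eqxx => /(_ isT); rewrite -!/(upd _ _ _).
    congr (runs _ _ _ _); apply: conf_eq => y; rewrite /upd.
    by case: eqP.
  have -> : x - j = (x - j.+1).+1 by lia.
  exact: runs_skip_entry.
have hu : upd f r 0 r = 0 by rewrite /upd eqxx.
apply: (runs_seq (runs_count_entry x hu)).
have := @runs_rewind (pos x - Posz (nth 0 a x))%R (upd (upd f r 0) r (nth 0 a x)).
have -> : upd (upd f r 0) r (nth 0 a x) = upd f r (nth 0 a x).
  by apply: funext => y; rewrite /upd; case: eqP.
apply.
case e : (drop x a) => [|v b].
  have -> : nth 0 a x = 0 by rewrite -[x]addn0 -nth_drop e nth_nil.
  by rewrite /pos e /=; lia.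
have -> : nth 0 a x = v by rewrite -[x]addn0 -nth_drop e.
have [_ ->] := word_at e.
have : size w = size (table_word (take x a)) + size (table_word (v :: b)).
  by rewrite /w -{1}(cat_take_drop x a) table_word_cat size_cat e addnC.
by rewrite /= size_cat /=; lia.
Qed.

End Lookup.

Definition write_cell (i : nat) (x : cell) : tprog := Act i (fun=> (x, MoveRight)).

Lemma act_write_end (x : cell) (w : seq cell) :
  act (fun=> (x, MoveRight)) (end_tape w) = end_tape (rcons w x).
Proof.
rewrite /act /end_tape /= size_rcons; congr pair; first by lia.
apply: funext => z; case: z => [n|n] //=.
rewrite nth_rcons; case: (ltngtP n (size w)) => [h|h|->].
- by case: eqP => // -[e]; move: h; rewrite e ltnn.
- by case: eqP => [[e]|_]; [move: h; rewrite e ltnn|rewrite nth_default // ltnW].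
- by rewrite eqxx.
Qed.

Definition push (r : nat) : tprog :=
  Seq (write_cell 2 comma) (while_pos r (Seq (dec r) (write_cell 2 mark))).

Lemma runs_push tin tout a f r :
  runs (push r) (conf tin tout (table_tape a) f) (3 * f r + 2)
    (conf tin tout (table_tape (f r :: a)) (upd f r 0)).
Proof.
have -> : 3 * f r + 2 = 1 + (f r * 3).+1 by lia.
have hw x w g : runs (write_cell 2 x) (conf tin tout (end_tape w) g) 1
    (conf tin tout (end_tape (rcons w x)) g).
  by have := runs_act 2 (fun=> (x, MoveRight)) (conf tin tout (end_tape w) g);
     rewrite upd_conf_arr /= act_write_end.
apply: (runs_seq (hw _ _ _)).
rewrite -cats1.
have := @runs_while r.+3 (fun y => isSome y) (Seq (dec r) (write_cell 2 mark))
  (fun j => conf tin tout (end_tape (table_word a ++ comma :: nseq (f r - j) mark)) (upd f r j))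
  2 (f r).
rewrite subn0 subnn upd_id; apply; first by rewrite scanned_reg /upd eqxx.
move=> j hj; rewrite scanned_reg /upd eqxx; split => //; rewrite -!/(upd _ _ _).
apply: (@runs_seq _ _ _ 1 (conf tin tout
    (end_tape (table_word a ++ comma :: nseq (f r - j.+1) mark)) (upd f r j)) 1).
  have := @runs_dec tin tout (end_tape (table_word a ++ comma :: nseq (f r - j.+1) mark))
    (upd f r j.+1) r.
  rewrite /upd eqxx => /(_ isT); rewrite -!/(upd _ _ _).
  congr (runs _ _ _ _); apply: conf_eq => y; rewrite /upd.
  by case: eqP.
have := hw mark (table_word a ++ comma :: nseq (f r - j.+1) mark) (upd f r j).
have -> : f r - j = (f r - j.+1).+1 by lia.
rewrite -cats1 -catA cat_cons -[[:: mark]]/(nseq 1 mark) -nseqD.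
by rewrite addn1.
Qed.

(** * Functions computable in polynomial time in the values of unary registers *)

(** The data available to a function: numbers held in registers, and a list on the table tape. Its
    size adds up values and not numbers of digits, because both kinds of data are stored in
    unary. *)
Record context := Context {
  context_sort :> Type;
  context_vars : context_sort -> seq nat;
  context_table : context_sort -> seq nat
}.

Definition extend (C : context) : context :=
  @Context (C * nat)%type (fun x => rcons (context_vars x.1) x.2)
    (fun x => context_table x.1).

Definition context_size (C : context) (x : C) : nat :=
  sumn (context_vars x) + sumn (context_table x) + size (context_table x).

Lemma context_size_extend (C : context) (x : C) (i : nat) :
  @context_size (extend C) (x, i) = context_size x + i.
Proof. by rewrite /context_size /= sumn_rcons; lia. Qed.

(** The base is at least 2, so a single exponent also absorbs constants and sums. *)
Definition poly_bounded (C : context) (f : C -> nat) : Prop :=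
  exists k, forall x, f x <= (context_size x + 2) ^ k.

Arguments poly_bounded : clear implicits.

Lemma leq_expnl (k m n : nat) : m <= n -> m ^ k <= n ^ k.
Proof. by case: k => // k h; rewrite leq_exp2r. Qed.

Section PolyBounded.
Variable C : context.
Implicit Types f g : C -> nat.

Lemma poly_bounded_le f g :
  (forall x, f x <= g x) -> poly_bounded C g -> poly_bounded C f.
Proof. by move=> h [k hk]; exists k => x; apply: leq_trans (h x) (hk x). Qed.

Lemma poly_bounded_const c : poly_bounded C (fun=> c).
Proof.
exists c => x; apply: (@leq_trans (2 ^ c)); first exact: ltnW (ltn_expl _ _).
by apply: leq_expnl; lia.
Qed.

Lemma poly_bounded_size : poly_bounded C (@context_size C).
Proof. by exists 1 => x; rewrite expn1; lia. Qed.

Lemma poly_bounded_mul f g :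
  poly_bounded C f -> poly_bounded C g -> poly_bounded C (fun x => f x * g x).
Proof.
by move=> [k hk] [l hl]; exists (k + l) => x; rewrite expnD leq_mul.
Qed.

Lemma poly_bounded_add f g :
  poly_bounded C f -> poly_bounded C g -> poly_bounded C (fun x => f x + g x).
Proof.
move=> [k hk] [l hl]; exists (k + l).+1 => x; rewrite expnS expnD.
have hk1 : 0 < (context_size x + 2) ^ k by rewrite expn_gt0 addn2.
have hl1 : 0 < (context_size x + 2) ^ l by rewrite expn_gt0 addn2.
have := hk x; have := hl x; nia.
Qed.

Lemma poly_bounded_succ f : poly_bounded C f -> poly_bounded C (fun x => (f x).+1).
Proof.
move=> hf; apply: poly_bounded_le (poly_bounded_add hf (poly_bounded_const 1)) => x.
by rewrite addn1.
Qed.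

Lemma poly_bounded_exp f k : poly_bounded C f -> poly_bounded C (fun x => f x ^ k).
Proof.
move=> hf; elim: k => [|k IH]; first exact: (poly_bounded_const 1).
by apply: poly_bounded_le (poly_bounded_mul hf IH) => x; rewrite expnS.
Qed.

(** Turns the cost of a loop body, which depends on the loop index, into one bound for all
    iterations. *)
Lemma poly_bounded_sup (h : extend C -> nat) (g : C -> nat) :
  poly_bounded (extend C) h -> poly_bounded C g ->
  exists2 b, poly_bounded C b & forall x i, i <= g x -> h (x, i) <= b x.
Proof.
move=> [k hk] hg; exists (fun x => (context_size x + g x + 2) ^ k).
  apply: poly_bounded_exp; apply: poly_bounded_add (poly_bounded_const 2).
  exact: poly_bounded_add poly_bounded_size hg.
move=> x i hi; apply: leq_trans (hk _) _; rewrite context_size_extend.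
by apply: leq_expnl; lia.
Qed.

End PolyBounded.

(** The registers form a stack [env], with the variables at the positions [pos]. A program leaves
    its result in the first free register and everything above it at zero, so programs compose by
    stacking. *)
Definition evaluates (C : context) (f : C -> nat)
    (p : seq nat -> nat -> tprog) (cost : C -> nat) : Prop :=
  forall x pos env tin tout,
    map (nth 0 env) pos = context_vars x -> all (gtn (size env)) pos ->
    runs (p pos (size env))
      (conf tin tout (table_tape (context_table x)) (nth 0 env)) (cost x)
      (conf tin tout (table_tape (context_table x)) (nth 0 (rcons env (f x)))).

(** The bound on the values belongs to the notion: the cost of an operation is polynomial in the
    contents of its registers, so compositions stay polynomial only if intermediate values do. *)
Definition polytime (C : context) (f : C -> nat) : Prop :=
  poly_bounded C f /\
  exists p, exists2 cost, poly_bounded C cost & evaluates f p cost.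

Arguments polytime : clear implicits.

Lemma upd_rcons (env : seq nat) (u v : nat) :
  upd (nth 0 (rcons env u)) (size env) v = nth 0 (rcons env v).
Proof.
apply: funext => k; rewrite /upd !nth_rcons.
by case: ltngtP => // h; case: eqP => //; lia.
Qed.

Lemma upd_end (env : seq nat) (v : nat) :
  upd (nth 0 env) (size env) v = nth 0 (rcons env v).
Proof.
rewrite -(upd_rcons env 0); congr upd.
apply: funext => k; rewrite nth_rcons.
by case: ltngtP => // h; rewrite nth_default // ?h // ltnW.
Qed.

Lemma nth_rcons_end (env : seq nat) (v : nat) : nth 0 (rcons env v) (size env) = v.
Proof. by rewrite nth_rcons ltnn eqxx. Qed.

Lemma map_nth_rcons (env pos : seq nat) (v : nat) : all (gtn (size env)) pos ->
  map (nth 0 (rcons env v)) pos = map (nth 0 env) pos.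
Proof.
move=> /allP h; apply/eq_in_map => k hk; rewrite nth_rcons.
by have /= -> := h k hk.
Qed.

Lemma nth_rcons2 (env : seq nat) (u v j : nat) :
  nth 0 (rcons (rcons env u) v) j =
  if j == size env then u else if j == (size env).+1 then v else nth 0 env j.
Proof.
rewrite !nth_rcons size_rcons ltnS.
case: (ltngtP j (size env)) => [h|h|e] //.
- by rewrite ifF //; lia.
- by rewrite (nth_default _ (ltnW h)).
Qed.

(** * Basic functions and bounded recursion *)

Section Polytime.
Variable C : context.

Lemma polytime_ext (f g : C -> nat) : (forall x, f x = g x) -> polytime C f -> polytime C g.
Proof. by move=> /funext ->. Qed.

Lemma polytime_weaken (f : C -> nat) : polytime C f -> polytime (extend C) (fun x => f x.1).
Proof.
have hb g : poly_bounded C g -> poly_bounded (extend C) (fun x => g x.1).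
  move=> [k hk]; exists k => -[x i] /=; apply: leq_trans (hk x) _.
  by apply: leq_expnl; rewrite context_size_extend; lia.
move=> [hf [p [cost hcost hp]]]; split; first exact: hb.
exists (fun pos => p (take (size pos).-1 pos)), (fun x => cost x.1); first exact: hb.
move=> [x i] pos env tin tout /= hpos hall; apply: hp.
  have hs : size pos = (size (context_vars x)).+1.
    by rewrite -(size_rcons _ i) -hpos size_map.
  by rewrite map_take hpos hs /= -cats1 take_size_cat.
by rewrite -(cat_take_drop (size pos).-1 pos) all_cat in hall; case/andP: hall.
Qed.

Lemma polytime_last : polytime (extend C) (fun x => x.2).
Proof.
split; first by exists 1 => -[x i]; rewrite context_size_extend expn1 /=; lia.
exists (fun pos b => copy (last 0 pos) b b.+1), (fun x => 10 * x.2 + 2).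
  by exists 5 => -[x i] /=; rewrite context_size_extend; nia.
move=> [x i] pos env tin tout /= hpos hall.
have hi : nth 0 env (last 0 pos) = i.
  case/lastP: pos hpos {hall} => [|pos k]; first by case: (context_vars x).
  by rewrite map_rcons last_rcons => /rcons_inj [].
have hl : last 0 pos < size env.
  case/lastP: pos hpos hall {hi} => [|pos k]; first by case: (context_vars x).
  by rewrite last_rcons all_rcons => _ /andP[].
rewrite -upd_end -hi; apply: runs_copy.
- by apply/eqP; lia.
- by apply/eqP; lia.
- by apply/eqP; lia.
- by rewrite nth_default.
- by rewrite nth_default.
Qed.

Lemma polytime_zero : polytime C (fun=> 0).
Proof.
split; first exact: poly_bounded_const.
exists (fun _ _ => skip), (fun=> 1); first exact: poly_bounded_const.
move=> x pos env tin tout _ _; rewrite -upd_end.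
have -> : upd (nth 0 env) (size env) 0 = nth 0 env.
  by apply: funext => k; rewrite /upd; case: eqP => // ->; rewrite nth_default.
exact: runs_skip.
Qed.

Lemma polytime_succ (f : C -> nat) : polytime C f -> polytime C (fun x => (f x).+1).
Proof.
move=> [hf [p [cost hcost hp]]]; split.
  by apply: poly_bounded_le (poly_bounded_add hf (poly_bounded_const C 1)) => x; lia.
exists (fun pos b => Seq (p pos b) (inc b)), (fun x => cost x + 2).
  exact: poly_bounded_add hcost (poly_bounded_const C 2).
move=> x pos env tin tout hpos hall; apply: (runs_seq (hp x pos env tin tout hpos hall)).
have := runs_inc tin tout (table_tape (context_table x)) (nth 0 (rcons env (f x))) (size env).
by rewrite nth_rcons_end upd_rcons.
Qed.

Lemma polytime_const c : polytime C (fun=> c).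
Proof. by elim: c => [|c IH]; [exact: polytime_zero|exact: polytime_succ]. Qed.

Lemma polytime_table (f : C -> nat) :
  polytime C f -> polytime C (fun x => nth 0 (context_table x) (f x)).
Proof.
move=> [hf [p [cost hcost hp]]].
have hn (a : seq nat) i : nth 0 a i <= sumn a.
  by elim: a i => [|v a IH] [|i] //=; [lia|have := IH i; lia].
split.
  apply: poly_bounded_le (poly_bounded_size C) => x; apply: leq_trans (hn _ _) _.
  by rewrite /context_size; lia.
exists (fun pos b => Seq (p pos b) (lookup b)),
  (fun x => cost x + (f x * (2 * context_size x + 5) + 6 * context_size x + 5)).
  have hs := poly_bounded_size C; have hk := poly_bounded_const C.
  apply: poly_bounded_add hcost _; apply: poly_bounded_add (hk 5).
  apply: poly_bounded_add; last exact: poly_bounded_mul (hk 6) hs.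
  by apply: poly_bounded_mul hf _; apply: poly_bounded_add (poly_bounded_mul (hk 2) hs) (hk 5).
move=> x pos env tin tout hpos hall; apply: (runs_seq (hp x pos env tin tout hpos hall)).
have := runs_lookup tin tout (context_table x) (nth 0 (rcons env (f x))) (size env).
rewrite nth_rcons_end upd_rcons; apply: runs_le.
by rewrite /context_size; nia.
Qed.

Definition down_rec (s : nat -> nat -> nat) (z n : nat) : nat := foldr s z (iota 0 n).

(** Recursion alone would leave polynomial time, as repeated doubling shows; a polynomial bound on
    every intermediate accumulator prevents this. The index runs downwards because the loop consumes
    its counter. *)
Lemma polytime_rec (n z : C -> nat) (s : C -> nat -> nat -> nat) (bound : C -> nat) :
  polytime C n -> polytime C z ->
  polytime (extend (extend C)) (fun x => s x.1.1 x.1.2 x.2) ->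
  poly_bounded C bound ->
  (forall x m, m <= n x -> foldr (s x) (z x) (iota m (n x - m)) <= bound x) ->
  polytime C (fun x => down_rec (s x) (z x) (n x)).
Proof.
move=> [hn [pn [cn hcn rn]]] [hz [pz [cz hcz rz]]] [hs [ps [cs hcs rs]]] hb hacc.
pose acc x m := foldr (s x) (z x) (iota m (n x - m)).
have acc_n x : acc x (n x) = z x by rewrite /acc subnn.
have acc_S x m : m < n x -> acc x m = s x m (acc x m.+1).
  by move=> hm; rewrite /acc (_ : n x - m = (n x - m.+1).+1) //; lia.
have hacc' x m : m <= n x -> acc x m <= bound x by exact: hacc.
have -> : (fun x => down_rec (s x) (z x) (n x)) = (fun x => acc x 0).
  by apply: funext => x; rewrite /acc subn0.
split; first by apply: poly_bounded_le hb => x; apply: hacc'.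
have [k hk] := hcs.
pose B x := (context_size x + n x + bound x + 2) ^ k.
have hB : poly_bounded C B.
  apply: poly_bounded_exp; apply: poly_bounded_add (poly_bounded_const C 2).
  apply: poly_bounded_add hb; exact: poly_bounded_add (poly_bounded_size C) hn.
have hBc x i m : i < n x -> m <= n x -> cs (x, i, acc x m) <= B x.
  move=> hi hm; apply: leq_trans (hk _) _; rewrite !context_size_extend.
  by apply: leq_expnl; have := hacc' x m hm; lia.
(* The counter sits in [b], the accumulator in [b.+1], and its successor is computed in [b.+2] and
   moved down. At the end [b] is zero and receives the result. *)
exists (fun pos b => Seq (pn pos b) (Seq (pz pos b.+1) (Seq
  (while_pos b (Seq (dec b) (Seq (ps (rcons (rcons pos b) b.+1) b.+2)
    (Seq (clear b.+1) (transfer b.+2 b.+1)))))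
  (transfer b.+1 b)))).
exists (fun x => cn x + (cz x + ((n x * (B x + 6 * bound x + 3).+1).+1 + (4 * bound x).+1))).
  have hc := poly_bounded_const C.
  apply: poly_bounded_add hcn _; apply: poly_bounded_add hcz _; apply: poly_bounded_add.
    apply: poly_bounded_succ; apply: poly_bounded_mul hn _; apply: poly_bounded_succ.
    by apply: poly_bounded_add (hc 3); apply: poly_bounded_add hB (poly_bounded_mul (hc 6) hb).
  exact: poly_bounded_succ (poly_bounded_mul (hc 4) hb).
move=> x pos env tin tout hpos hall.
have hall1 : all (gtn (size env).+1) pos by apply: sub_all hall => j /=; lia.
apply: (runs_seq (rn x pos env tin tout hpos hall)).
have hz1 := rz x pos (rcons env (n x)) tin tout.
rewrite map_nth_rcons // size_rcons in hz1.
apply: (runs_seq (hz1 hpos hall1)).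
pose F m := nth 0 (rcons (rcons env m) (acc x m)).
pose Tb := table_tape (context_table x).
apply: (@runs_seq _ _ _ _ (conf tin tout Tb (F 0))).
  rewrite -acc_n; apply: (@runs_while_pos _ _ _ _ _ _ (n x) F) => [m _|m hm].
    by rewrite /F nth_rcons size_rcons ltnS leqnn nth_rcons_end.
  have h1 := @runs_dec tin tout Tb (F m.+1) (size env).
  have e1 : F m.+1 (size env) = m.+1.
    by rewrite /F nth_rcons size_rcons ltnS leqnn nth_rcons_end.
  pose G := rcons (rcons env m) (acc x m.+1).
  have e2 : upd (F m.+1) (size env) m = nth 0 G.
    by apply: funext => j; rewrite /upd /F /G !nth_rcons2; case: eqP.
  rewrite e1 /= e2 in h1.
  apply: (@runs_le _ _ (1 + (B x + ((2 * bound x).+1 + (4 * bound x).+1)))); first by lia.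
  apply: (runs_seq (h1 isT)).
  have h2 := rs (x, m, acc x m.+1) (rcons (rcons pos (size env)) (size env).+1) G tin tout.
  have sG : size G = (size env).+2 by rewrite !size_rcons.
  rewrite sG /= -acc_S // in h2.
  apply: (@runs_seq _ _ _ _ (conf tin tout Tb (nth 0 (rcons G (acc x m))))).
    apply: (@runs_le _ _ (cs (x, m, acc x m.+1))); first by apply: hBc.
    apply: h2.
      rewrite !map_rcons /G map_nth_rcons; last by rewrite size_rcons.
      by rewrite map_nth_rcons // hpos !nth_rcons2 eqxx ifF ?eqxx //; lia.
    rewrite !all_rcons /= ltnS leqnn leqW //=.
    by apply: sub_all hall => j /=; lia.
  have h3 := @runs_clear tin tout Tb (nth 0 (rcons G (acc x m))) (size env).+1.
  have e3 : nth 0 (rcons G (acc x m)) (size env).+1 = acc x m.+1.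
    by rewrite nth_rcons sG ltnS leqnn /G -(size_rcons env m) nth_rcons_end.
  rewrite e3 in h3.
  apply: (@runs_seq _ _ _ _ (conf tin tout Tb
     (upd (nth 0 (rcons G (acc x m))) (size env).+1 0))).
    by apply: runs_le h3; have := hacc' x m.+1 hm; lia.
  have h4 := @runs_transfer tin tout Tb
     (upd (nth 0 (rcons G (acc x m))) (size env).+1 0) (size env).+2 (size env).+1.
  have e4 : upd (nth 0 (rcons G (acc x m))) (size env).+1 0 (size env).+2 = acc x m.
    by rewrite /upd ifF -?sG ?nth_rcons_end //; apply/eqP; lia.
  rewrite e4 in h4.
  apply: (@runs_le _ _ ((4 * acc x m).+1)); first by have := hacc' x m (ltnW hm); lia.
  have hne : (size env).+2 != (size env).+1 by apply/eqP; lia.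
  have := h4 hne; congr (runs _ _ _ _); apply: conf_eq => j.
  rewrite /upd !nth_rcons sG /F /G !nth_rcons2 eqxx.
  rewrite size_rcons; case: (j =P (size env).+1) => [->|h5].
    by rewrite ifF //; lia.
  case: (j =P (size env).+2) => [->|h6]; first by rewrite ifF ?nth_default //; lia.
  case: (j =P size env) => [->|h7].
    have -> : size env < (size env).+2 = true by lia.
    by rewrite ltnSn ltnn.
  case: (ltnP j (size env)) => h8; last first.
    by rewrite (nth_default 0 h8); case: (j < _) => //; case: (j < _).
  have -> : j < (size env).+2 = true by lia.
  by have -> : j < (size env).+1 = true by lia.
have hne : (size env).+1 != size env by apply/eqP; lia.
have h5 := @runs_transfer tin tout Tb (F 0) _ _ hne.
have e5 : F 0 (size env) = 0 by rewrite /F nth_rcons2 eqxx.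
have e6 : F 0 (size env).+1 = acc x 0 by rewrite /F nth_rcons2 (negbTE hne) eqxx.
rewrite e5 e6 in h5.
apply: (@runs_le _ _ ((4 * acc x 0).+1)); first by have := hacc' x 0 (leq0n _); lia.
move: h5; congr (runs _ _ _ _); apply: conf_eq => j.
rewrite /upd /F nth_rcons2 nth_rcons; case: (j =P size env) => [->|h7].
  by rewrite ltnn.
case: (j =P _) => [->|h8]; first by rewrite ifF //; lia.
by case: ifP => // h9; rewrite nth_default //; lia.
Qed.

End Polytime.

(** * Arithmetic in polynomial time *)

Lemma foldr_iota_iter (g : nat -> nat) (z m k : nat) :
  foldr (fun=> g) z (iota m k) = iter k g z.
Proof. by elim: k m => //= k IH m; rewrite IH. Qed.

Section Closure.
Variable C : context.
Implicit Types (f g n : C -> nat) (b c : C -> bool).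

Lemma polytime_sum n (F : C -> nat -> nat) :
  polytime C n -> polytime (extend C) (fun x => F x.1 x.2) ->
  polytime C (fun x => \sum_(i < n x) F x i).
Proof.
move=> hn hF.
have [B hB hFB] := poly_bounded_sup (hF.1) (hn.1).
have heq x m : foldr (fun i a => F x i + a) 0 (iota m (n x - m)) = \sum_(m <= i < n x) F x i.
  by rewrite unlock.
apply: (@polytime_ext _ (fun x => down_rec (fun i a => F x i + a) 0 (n x))) => [x|].
  by rewrite /down_rec -[in iota _ _](subn0 (n x)) heq big_mkord.
apply: (polytime_rec hn (polytime_zero C) _ (poly_bounded_mul hn.1 hB)).
  (* Addition is needed in the context of the loop body, an extension of [C], so it is derived here
     for every context. *)
  have hadd (D : context) (h k : D -> nat) : polytime D h -> polytime D k ->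
      polytime D (fun x => h x + k x).
    move=> hh hk.
    apply: (@polytime_ext _ (fun x => down_rec (fun=> succn) (h x) (k x))) => [x|].
      by rewrite /down_rec foldr_iota_iter iter_succn addnC.
    apply: (polytime_rec hk hh _ (poly_bounded_add hh.1 hk.1)).
      exact: (polytime_succ (polytime_last _)).
    by move=> x m hm; rewrite foldr_iota_iter iter_succn; lia.
  by apply: hadd; [exact: (polytime_weaken hF)|exact: polytime_last].
move=> x m hm; rewrite heq.
apply: leq_trans (_ : \sum_(m <= i < n x) B x <= _).
  rewrite [leqLHS]big_nat_cond [leqRHS]big_nat_cond.
  by apply: leq_sum => i /andP[/andP[_ hi] _]; exact/hFB/ltnW.
by rewrite sum_nat_const_nat leq_mul2r; apply/orP; right; lia.
Qed.

Lemma polytime_iter n f (G : C -> nat -> nat) (bound : C -> nat) :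
  polytime C n -> polytime C f -> polytime (extend C) (fun x => G x.1 x.2) ->
  poly_bounded C bound ->
  (forall x m, m <= n x -> iter m (G x) (f x) <= bound x) ->
  polytime C (fun x => iter (n x) (G x) (f x)).
Proof.
move=> hn hf hG hb hi.
apply: (@polytime_ext _ (fun x => down_rec (fun=> G x) (f x) (n x))) => [x|].
  by rewrite /down_rec foldr_iota_iter.
apply: (polytime_rec hn hf _ hb) => [|x m hm]; last by rewrite foldr_iota_iter; apply: hi; lia.
case: hG => [hG1 [p [cost hcost hp]]].
(* The step function does not see the loop index, so its program is run with that register dropped
   from [pos]. *)
pose h (x : extend (extend C)) : extend C := (x.1.1, x.2).
have hle x : context_size (h x) <= context_size x.
  by case: x => [[x i] a]; rewrite /h !context_size_extend /=; lia.
have hbd u : poly_bounded (extend C) u -> poly_bounded _ (u \o h).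
  move=> [k hk]; exists k => x; apply: leq_trans (hk _) _.
  by apply: leq_expnl; have := hle x; lia.
split; first exact: (hbd _ hG1).
exists (fun pos => p (rcons (take (size pos).-2 pos) (last 0 pos))), (cost \o h).
  exact: hbd.
move=> [[x i] a] pos env tin tout /= hpos hall; apply: hp.
  case/lastP: pos hpos hall => [|pos k]; first by case: (context_vars x) => [|? []].
  case/lastP: pos => [|pos l].
    by case: (context_vars x) => [|? [|? ?]].
  rewrite !map_rcons => /rcons_inj[/rcons_inj[e1 _] e2] _ /=.
  by rewrite !size_rcons /= last_rcons -[rcons (rcons pos l) k]cats1 -[rcons pos l]cats1
    -catA take_size_cat // e1 e2.
case/lastP: pos hpos hall => [|pos k]; first by case: (context_vars x) => [|? []].
case/lastP: pos => [|pos l].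
  by case: (context_vars x) => [|? [|? ?]].
move=> _; rewrite !all_rcons !size_rcons /= last_rcons -[rcons (rcons pos l) k]cats1
  -[rcons pos l]cats1 -catA take_size_cat //.
by move=> /and3P[-> _ ->].
Qed.

Lemma polytime_add f g : polytime C f -> polytime C g -> polytime C (fun x => f x + g x).
Proof.
move=> hf hg.
apply: (@polytime_ext _ (fun x => iter (g x) succn (f x))) => [x|].
  by rewrite iter_succn addnC.
apply: (polytime_iter (G := fun=> succn) hg hf (polytime_succ (polytime_last _))
  (poly_bounded_add hf.1 hg.1)).
by move=> x m; rewrite iter_succn; lia.
Qed.

Lemma polytime_mul f g : polytime C f -> polytime C g -> polytime C (fun x => f x * g x).
Proof.
move=> hf hg; apply: (@polytime_ext _ (fun x => \sum_(i < f x) g x)) => [x|].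
  by rewrite sum_nat_const card_ord.
exact: (polytime_sum (F := fun x _ => g x) hf (polytime_weaken hg)).
Qed.

Lemma polytime_expn f k : polytime C f -> polytime C (fun x => f x ^ k).
Proof.
move=> hf; elim: k => [|k IH]; first exact: polytime_const.
apply: (@polytime_ext _ (fun x => f x * f x ^ k)); last exact: polytime_mul.
by move=> x; rewrite expnS.
Qed.

Lemma polytime_gt0 f : polytime C f -> polytime C (fun x => 0 < f x).
Proof.
move=> hf; apply: (@polytime_ext _ (fun x => iter (f x) (fun=> 1) 0)) => [x|].
  by case: (f x) => // m; elim: m.
apply: (polytime_iter (G := fun=> fun=> 1) hf (polytime_zero C) (polytime_const _ 1)
  (poly_bounded_const C 1)).
by move=> x [|m] //= _; elim: m.
Qed.

End Closure.

Section Arithmetic.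
Variable C : context.
Implicit Types (f g n : C -> nat) (b c : C -> bool).

Lemma polytime_pred f : polytime C f -> polytime C (fun x => (f x).-1).
Proof.
move=> hf; apply: (@polytime_ext _ (fun x => \sum_(i < f x) (0 < i))) => [x|].
  case: (f x) => [|m]; first by rewrite big_ord0.
  by rewrite big_ord_recl add0n (eq_bigr (fun=> 1)) // sum1_card card_ord.
exact: (polytime_sum (F := fun _ i => 0 < i) hf (polytime_gt0 (polytime_last _))).
Qed.

End Arithmetic.

Section Comparison.
Variable C : context.
Implicit Types (f g n : C -> nat) (b c : C -> bool).

Lemma polytime_sub f g : polytime C f -> polytime C g -> polytime C (fun x => f x - g x).
Proof.
move=> hf hg; have e m k : iter k predn m = m - k.
  by elim: k => [|k IH] /=; rewrite ?subn0 // IH -subnS.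
apply: (@polytime_ext _ (fun x => iter (g x) predn (f x))) => //.
apply: (polytime_iter (G := fun=> predn) hg hf (polytime_pred (polytime_last _)) hf.1).
by move=> x m _; rewrite e leq_subr.
Qed.

Lemma polytime_negb b : polytime C b -> polytime C (fun x => ~~ b x).
Proof.
move=> hb; apply: polytime_ext (polytime_sub (polytime_const C 1) hb) => x.
by case: (b x).
Qed.

Lemma polytime_andb b c : polytime C b -> polytime C c -> polytime C (fun x => b x && c x).
Proof.
move=> hb hc; apply: polytime_ext (polytime_mul hb hc) => x.
by case: (b x); case: (c x).
Qed.

Lemma polytime_orb b c : polytime C b -> polytime C c -> polytime C (fun x => b x || c x).
Proof.
move=> hb hc; apply: polytime_ext (polytime_gt0 (polytime_add hb hc)) => x.
by case: (b x); case: (c x).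
Qed.

Lemma polytime_leq f g : polytime C f -> polytime C g -> polytime C (fun x => f x <= g x).
Proof.
move=> hf hg; apply: polytime_ext (polytime_negb (polytime_gt0 (polytime_sub hf hg))) => x.
by rewrite -leqNgt leqn0.
Qed.

Lemma polytime_eq f g : polytime C f -> polytime C g -> polytime C (fun x => f x == g x).
Proof.
move=> hf hg.
apply: polytime_ext (polytime_andb (polytime_leq hf hg) (polytime_leq hg hf)) => x.
by rewrite eqn_leq.
Qed.

Lemma polytime_if b f g : polytime C b -> polytime C f -> polytime C g ->
  polytime C (fun x => if b x then f x else g x).
Proof.
move=> hb hf hg.
apply: polytime_ext (polytime_add (polytime_mul hb hf) (polytime_mul (polytime_negb hb) hg)) => x.
by case: (b x); lia.
Qed.

Lemma polytime_has n (F : C -> nat -> bool) :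
  polytime C n -> polytime (extend C) (fun x => F x.1 x.2) ->
  polytime C (fun x => has (F x) (iota 0 (n x))).
Proof.
move=> hn hF; apply: polytime_ext (polytime_gt0 (polytime_sum (F := F) hn hF)) => x.
rewrite -(big_mkord xpredT (fun i => nat_of_bool (F x i))) /= /index_iota subn0.
by rewrite has_count -sum1_count [in RHS]big_mkcond.
Qed.

End Comparison.

Lemma sum_ltn_ord (m q : nat) : \sum_(k < m) (k < q) = minn m q.
Proof.
elim: m => [|m IH]; first by rewrite big_ord0 min0n.
by rewrite big_ord_recr /= IH; case: (ltnP m q) => h; lia.
Qed.

Section Division.
Variable C : context.
Implicit Types (f g n : C -> nat).

(** The quotient is the number of [k < f x] with [k.+1 * g x <= f x]; the factor [0 < g x]
    reproduces the convention that division by zero gives 0. *)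
Lemma polytime_div f g : polytime C f -> polytime C g -> polytime C (fun x => f x %/ g x).
Proof.
move=> hf hg.
apply: (@polytime_ext _ (fun x => (0 < g x) * \sum_(k < f x) (k.+1 * g x <= f x))) => [x|].
  case: (posnP (g x)) => [->|h]; first by rewrite divn0.
  rewrite mul1n (eq_bigr (fun k : 'I__ => nat_of_bool (k < f x %/ g x))) => [|k _].
    by rewrite sum_ltn_ord; apply/minn_idPr/leq_div.
  by rewrite leq_divRL.
apply: polytime_mul; first exact: polytime_gt0.
apply: (polytime_sum (F := fun x k => k.+1 * g x <= f x) hf).
apply: polytime_leq (polytime_weaken hf).
exact: polytime_mul (polytime_succ (polytime_last _)) (polytime_weaken hg).
Qed.

Lemma polytime_mod f g : polytime C f -> polytime C g -> polytime C (fun x => f x %% g x).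
Proof.
move=> hf hg; apply: polytime_ext (polytime_sub hf (polytime_mul (polytime_div hf hg) hg)) => x.
by rewrite {1}(divn_eq (f x) (g x)) addKn.
Qed.

End Division.

Section Powers.
Variable C : context.
Implicit Types (f g n : C -> nat).

Lemma polytime_odd f : polytime C f -> polytime C (fun x => odd (f x)).
Proof.
move=> hf; apply: polytime_ext (polytime_mod hf (polytime_const C 2)) => x.
by rewrite modn2.
Qed.

(** Repeated division never exceeds [f x], whereas the power [c ^ g x] may be exponentially
    large. *)
Lemma polytime_divexp c f g : polytime C f -> polytime C g ->
  polytime C (fun x => f x %/ c ^ g x).
Proof.
move=> hf hg; have e a k : iter k (fun a => a %/ c) a = a %/ c ^ k.
  by elim: k => [|k IH] /=; rewrite ?divn1 // IH -divnMA expnSr.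
apply: (@polytime_ext _ (fun x => iter (g x) (fun a => a %/ c) (f x))) => //.
apply: (polytime_iter (G := fun _ a => a %/ c) hg hf _ hf.1).
  exact: polytime_div (polytime_last _) (polytime_const _ c).
by move=> x m _; rewrite e leq_div.
Qed.

Lemma polytime_exp c f : 0 < c -> poly_bounded C (fun x => c ^ f x) -> polytime C f ->
  polytime C (fun x => c ^ f x).
Proof.
move=> hc hb hf; have e k : iter k (muln c) 1 = c ^ k.
  by elim: k => //= k ->; rewrite expnS.
apply: (@polytime_ext _ (fun x => iter (f x) (muln c) 1)) => //.
apply: (polytime_iter (G := fun=> muln c) hf (polytime_const C 1) _ hb).
  exact: polytime_mul (polytime_const _ c) (polytime_last _).
by move=> x m hm; rewrite e leq_pexp2l.
Qed.

End Powers.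

Lemma polytime_trunc_log2 (C : context) (f : C -> nat) :
  polytime C f -> polytime C (fun x => trunc_log 2 (f x)).
Proof.
move=> hf.
apply: (@polytime_ext _ (fun x => \sum_(t < f x) (0 < f x %/ 2 ^ t.+1))) => [x|].
  case: (posnP (f x)) => [->|h]; first by rewrite big_ord0 trunc_log0.
  rewrite (eq_bigr (fun k : 'I__ => nat_of_bool (k < trunc_log 2 (f x)))) => [|k _].
    rewrite sum_ltn_ord; apply/minn_idPr.
    by apply: leq_trans (trunc_logP (ltnSn 1) h); apply/ltnW/ltn_expl.
  rewrite divn_gt0 ?expn_gt0 //; congr nat_of_bool; apply/idP/idP => hk.
    exact: trunc_log_max.
  by apply: leq_trans (trunc_logP (ltnSn 1) h); rewrite leq_exp2l.
apply: (polytime_sum (F := fun x t => 0 < f x %/ 2 ^ t.+1) hf).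
apply: polytime_gt0.
exact: (polytime_divexp 2 (polytime_weaken hf) (polytime_succ (polytime_last _))).
Qed.

(** * Input, output and the table *)

Definition run_context : context :=
  @Context (nat * seq nat)%type (fun x => [:: x.1]) (fun x => x.2).

Definition input_context : context := @Context nat (fun n => [:: n]) (fun=> [::]).

Lemma input_context_size (n : input_context) : context_size n = n.
Proof. by rewrite /context_size /= !addn0. Qed.

Section Emit.
Variables (f : run_context -> nat) (hf : polytime run_context f).

Let len x := (trunc_log 2 (f x)).+1.
Let bit (y : extend run_context) : bool := odd (f y.1 %/ 2 ^ y.2).

Let hlen : polytime run_context len.
Proof. exact: polytime_succ (polytime_trunc_log2 hf). Qed.

Let hbit : polytime (extend run_context) bit.
Proof.
exact: (polytime_odd (polytime_divexp 2 (polytime_weaken hf) (polytime_last _))).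
Qed.

Lemma encode_nat_rcons (m j l : nat) : j < l ->
  [seq Bit (odd (m %/ 2 ^ i)) | i <- rev (iota j (l - j))] =
  rcons [seq Bit (odd (m %/ 2 ^ i)) | i <- rev (iota j.+1 (l - j.+1))]
    (Bit (odd (m %/ 2 ^ j))).
Proof.
by move=> h; rewrite (_ : l - j = (l - j.+1).+1) ?rev_cons ?map_rcons //; lia.
Qed.

(** Each binary digit is computed afresh from the unary value. The position counts down, so the most
    significant digit comes first. *)
Lemma runs_emit : exists p, exists2 cost, poly_bounded run_context cost &
  forall (n : nat) (a : seq nat) tin (w : seq symbol),
    runs p (conf tin (end_tape (map cell_of w)) (table_tape a) (nth 0 [:: n]))
      (cost (n, a))
      (conf tin (end_tape (map cell_of (w ++ encode_nat (f (n, a)))))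
        (table_tape a) (nth 0 [:: n])).
Proof.
have [_ [pl [cl hcl rl]]] := hlen.
have [_ [pb [cb hcb rb]]] := hbit.
have [B hB hcbB] := poly_bounded_sup hcb hlen.1.
exists (Seq (pl [:: 0] 1) (while_pos 1 (Seq (dec 1) (Seq (pb [:: 0; 1] 2)
  (Seq (If 5 (fun x => isSome x) (write_cell 1 (cell_of (Bit true)))
                                 (write_cell 1 (cell_of (Bit false))))
       (clear 2)))))).
exists (fun x => cl x + (len x * (B x + 6).+1).+1).
  apply: poly_bounded_add hcl _; apply: poly_bounded_succ.
  apply: poly_bounded_mul hlen.1 _; apply: poly_bounded_succ.
  exact: poly_bounded_add hB (poly_bounded_const _ _).
move=> n a tin w; set x := (n, a); set l := len x.
have hl := rl x [:: 0] [:: n] tin (end_tape (map cell_of w)) erefl erefl.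
apply: (runs_seq hl).
pose out j := map cell_of (w ++ [seq Bit (odd (f x %/ 2 ^ i)) | i <- rev (iota j (l - j))]).
have := @runs_while 4 (fun x => isSome x) (Seq (dec 1) (Seq (pb [:: 0; 1] 2)
  (Seq (If 5 (fun x => isSome x) (write_cell 1 (cell_of (Bit true)))
                                 (write_cell 1 (cell_of (Bit false))))
       (clear 2))))
  (fun j => conf tin (end_tape (out j)) (table_tape a) (nth 0 [:: n; j])) (B x + 6) l.
have -> : out l = map cell_of w by rewrite /out subnn cats0.
have -> : out 0 = map cell_of (w ++ encode_nat (f x)) by rewrite /out subn0.
have -> : nth 0 [:: n; 0] = nth 0 [:: n] by apply: funext => -[|[|[|[|k]]]].
apply; first by rewrite scanned_reg.
move=> j hj; rewrite scanned_reg; split => //.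
have hd := @runs_dec tin (end_tape (out j.+1)) (table_tape a) (nth 0 [:: n; j.+1]) 1 isT.
have eu : upd (nth 0 [:: n; j.+1]) 1 j = nth 0 [:: n; j].
  by apply: funext => -[|[|[|[|k]]]].
rewrite /= eu in hd.
apply: (@runs_le _ _ (1 + (B x + (2 + 3)))); first by lia.
apply: (runs_seq hd).
have hb := rb (x, j) [:: 0; 1] [:: n; j] tin (end_tape (out j.+1)) erefl erefl.
apply: (@runs_seq _ _ _ _ (conf tin (end_tape (out j.+1)) (table_tape a)
    (nth 0 [:: n; j; nat_of_bool (bit (x, j))]))).
  by apply: runs_le hb; apply: hcbB; apply: ltnW.
have ho : out j = rcons (out j.+1) (cell_of (Bit (bit (x, j)))).
  by rewrite /out encode_nat_rcons // -rcons_cat map_rcons.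
have hw y g : runs (write_cell 1 y) (conf tin (end_tape (out j.+1)) (table_tape a) g) 1
    (conf tin (end_tape (rcons (out j.+1) y)) (table_tape a) g).
  by have := runs_act 1 (fun=> (y, MoveRight))
       (conf tin (end_tape (out j.+1)) (table_tape a) g);
     rewrite upd_conf_out /= act_write_end.
apply: (@runs_seq _ _ _ _ (conf tin (end_tape (out j)) (table_tape a)
    (nth 0 [:: n; j; nat_of_bool (bit (x, j))]))).
  by apply: runs_if; rewrite scanned_reg ho /=; case: (bit (x, j)) => // _; exact: hw.
have := runs_clear tin (end_tape (out j)) (table_tape a)
  (nth 0 [:: n; j; nat_of_bool (bit (x, j))]) 2.
have -> : upd (nth 0 [:: n; j; nat_of_bool (bit (x, j))]) 2 0 = nth 0 [:: n; j].
  by apply: funext => -[|[|[|[|k]]]].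
by apply: runs_le => /=; case: (bit (x, j)).
Qed.

End Emit.

Section BuildTable.
Variables (size_of : nat -> nat) (entry : nat * seq nat * nat -> nat).
Variables (bound : nat -> nat).

(** When entry [i] is computed, the list holds exactly the entries of larger index, among them those
    of the children of node [i]. *)
Definition build_table (n m : nat) : seq nat :=
  foldr (fun i a => entry (n, a, i) :: a) [::] (iota m (size_of n - m)).

Hypothesis size_of_polytime : polytime run_context (fun x => size_of x.1).
Hypothesis size_of_bounded : poly_bounded input_context size_of.
Hypothesis entry_polytime : polytime (extend run_context) entry.
Hypothesis bound_bounded : poly_bounded input_context bound.
Hypothesis entry_le : forall n a i, entry (n, a, i) <= bound n.

Lemma build_tableS (n m : nat) : m < size_of n ->
  build_table n m = entry (n, build_table n m.+1, m) :: build_table n m.+1.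
Proof.
by move=> h; rewrite /build_table (_ : size_of n - m = (size_of n - m.+1).+1) //; lia.
Qed.

Lemma build_table_size (n m : nat) : m <= size_of n ->
  context_size (C := run_context) (n, build_table n m) <= n + size_of n * (bound n).+1.
Proof.
move=> hm; have : sumn (build_table n m) + size (build_table n m) <=
    (size_of n - m) * (bound n).+1.
  rewrite /build_table; move: (size_of n - m) => k.
  elim: k m {hm} => [|k IH] m //=.
  set a := foldr _ _ _; have := entry_le n a m; have := IH m.+1.
  by rewrite -/a mulSn; lia.
have : (size_of n - m) * (bound n).+1 <= size_of n * (bound n).+1.
  by rewrite leq_mul2r leq_subr orbT.
by rewrite /context_size /=; lia.
Qed.

(** Since [entry_le] holds for any list, all partial tables have size polynomial in [n], and a cost
    polynomial in [n] and the table is polynomial in [n] alone. *)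
Lemma poly_bounded_build (g : run_context -> nat) :
  poly_bounded run_context g ->
  exists2 c, poly_bounded input_context c &
    forall n m, m <= size_of n -> g (n, build_table n m) <= c n.
Proof.
move=> [k hk]; exists (fun n => (n + size_of n * (bound n).+1 + 2) ^ k).
  apply: poly_bounded_exp; apply: poly_bounded_add (poly_bounded_const _ _).
  apply: poly_bounded_add.
    by apply: poly_bounded_le (poly_bounded_size _) => n; rewrite input_context_size.
  exact: poly_bounded_mul size_of_bounded (poly_bounded_succ bound_bounded).
move=> n m hm; apply: leq_trans (hk _) _; apply: leq_expnl.
by have := build_table_size hm; lia.
Qed.

Lemma runs_build_table : exists p, exists2 cost, poly_bounded input_context cost &
  forall n tin tout,
    runs p (conf tin tout (table_tape [::]) (nth 0 [:: n])) (cost n)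
      (conf tin tout (table_tape (build_table n 0)) (nth 0 [:: n])).
Proof.
have [_ [ps [cs hcs rs]]] := size_of_polytime.
have [_ [pe [ce hce re]]] := entry_polytime.
have [b hb hceb] := poly_bounded_sup hce size_of_polytime.1.
have [B hB hbB] := poly_bounded_build hb.
have [B' hB' hbB'] := poly_bounded_build hcs.
exists (Seq (ps [:: 0] 1) (while_pos 1 (Seq (dec 1) (Seq (pe [:: 0; 1] 2) (push 2))))).
exists (fun n => B' n + (size_of n * (B n + (3 * bound n + 3)).+1).+1).
  apply: poly_bounded_add hB' _; apply: poly_bounded_succ.
  apply: poly_bounded_mul size_of_bounded _; apply: poly_bounded_succ.
  apply: poly_bounded_add hB _; apply: poly_bounded_add (poly_bounded_const _ _).
  exact: poly_bounded_mul (poly_bounded_const _ _) bound_bounded.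
move=> n tin tout; set l := size_of n.
have t0 : build_table n l = [::] by rewrite /build_table subnn.
have hs := rs (n, [::]) [:: 0] [:: n] tin tout erefl erefl.
apply: (@runs_seq _ _ _ _ (conf tin tout (table_tape [::]) (nth 0 [:: n; l]))).
  by apply: runs_le hs; rewrite -t0; exact: hbB'.
have := @runs_while 4 (fun x => isSome x) (Seq (dec 1) (Seq (pe [:: 0; 1] 2) (push 2)))
  (fun j => conf tin tout (table_tape (build_table n j)) (nth 0 [:: n; j]))
  (B n + (3 * bound n + 3)) l.
have -> : nth 0 [:: n; 0] = nth 0 [:: n] by apply: funext => -[|[|[|[|k]]]].
rewrite t0; apply; first by rewrite scanned_reg.
move=> j hj; rewrite scanned_reg; split => //.
set a := build_table n j.+1.
have hd := @runs_dec tin tout (table_tape a) (nth 0 [:: n; j.+1]) 1 isT.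
have eu : upd (nth 0 [:: n; j.+1]) 1 j = nth 0 [:: n; j].
  by apply: funext => -[|[|[|[|k]]]].
rewrite /= eu in hd.
apply: (@runs_le _ _ (1 + (B n + (3 * bound n + 2)))); first by lia.
apply: (runs_seq hd).
have he := re (n, a, j) [:: 0; 1] [:: n; j] tin tout erefl erefl.
apply: (@runs_seq _ _ _ _ (conf tin tout (table_tape a) (nth 0 [:: n; j; entry (n, a, j)]))).
  by apply: runs_le he; apply: leq_trans (hbB n j.+1 hj); apply: hceb; apply: ltnW.
have := runs_push tin tout a (nth 0 [:: n; j; entry (n, a, j)]) 2.
rewrite build_tableS // -/a.
have -> : upd (nth 0 [:: n; j; entry (n, a, j)]) 2 0 = nth 0 [:: n; j].
  by apply: funext => -[|[|[|[|k]]]].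
by apply: runs_le => /=; have := entry_le n a j; lia.
Qed.

End BuildTable.

(** Horner's rule from the leading digit on: register 0 is doubled by way of register 1, then the
    digit under the head is added. *)
Definition read_input : tprog :=
  While 0 (fun x => isSome x)
    (Seq (transfer 0 1)
    (Seq (while_pos 1 (Seq (dec 1) (Seq (inc 0) (inc 0))))
    (Seq (If 0 (fun x => x == cell_of (Bit true)) (inc 0) skip)
         (go 0 MoveRight)))).

Lemma runs_read_input (n : nat) tout tarr :
  exists tin, runs read_input
    (conf (0%R, word_cells (map cell_of (encode_nat n))) tout tarr (nth 0 [::]))
    ((trunc_log 2 n).+1 * (10 * n + 9).+1).+1
    (conf tin tout tarr (nth 0 [:: n])).
Proof.
set l := (trunc_log 2 n).+1.
have nl : n < 2 ^ l by rewrite /l; apply: trunc_log_ltn.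
set wd := word_cells _.
exists (Posz l, wd).
have wdE j : j < l -> wd (Posz (l - j.+1)) = cell_of (Bit (odd (n %/ 2 ^ j))).
  move=> hj; rewrite /wd /word_cells /encode_nat -map_comp -/l.
  rewrite (nth_map 0); last by rewrite size_rev size_iota; lia.
  rewrite nth_rev size_iota; last by lia.
  by rewrite nth_iota /=; [congr (cell_of (Bit (odd (n %/ 2 ^ _)))); lia|lia].
have := @runs_while 0 (fun x => isSome x) (Seq (transfer 0 1)
    (Seq (while_pos 1 (Seq (dec 1) (Seq (inc 0) (inc 0))))
    (Seq (If 0 (fun x => x == cell_of (Bit true)) (inc 0) skip)
         (go 0 MoveRight))))
  (fun j => conf (Posz (l - j), wd) tout tarr (nth 0 [:: n %/ 2 ^ j])) (10 * n + 9) l.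
rewrite subnn subn0 expn0 divn1 divn_small //.
have -> : nth 0 [:: 0] = nth 0 [::] by apply: funext => -[|[|[|[|k]]]].
apply.
  rewrite /scanned /= nth_default // size_map /encode_nat size_map size_rev size_iota.
  by rewrite leqnn.
move=> j hj; rewrite /scanned /= -[nth None _ _]/(wd (Posz (l - j.+1))) wdE //; split => //.
set v := n %/ 2 ^ j.+1.
have vn : v <= n by exact: leq_div.
have e : n %/ 2 ^ j = v + v + odd (n %/ 2 ^ j).
  by rewrite {1}(divn_eq (n %/ 2 ^ j) 2) modn2 -divnMA -expnSr /v; lia.
set tin := (_, wd).
have h1 := @runs_transfer tin tout tarr (nth 0 [:: v]) 0 1 isT.
have u1 : upd (upd (nth 0 [:: v]) 0 0) 1 (0 + v) = nth 0 [:: 0; v].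
  by apply: funext => -[|[|[|[|k]]]].
rewrite /= u1 in h1.
apply: (@runs_le _ _ ((4 * v).+1 + ((v * 6).+1 + (3 + 1)))); first by lia.
apply: (runs_seq h1).
apply: (@runs_seq _ _ _ _ (conf tin tout tarr (nth 0 [:: v + v]))).
  have := @runs_while_pos tin tout tarr 1 (Seq (dec 1) (Seq (inc 0) (inc 0))) 5 v
    (fun k => nth 0 [:: (v - k) + (v - k); k]).
  rewrite subnn subn0.
  have -> : nth 0 [:: v + v; 0] = nth 0 [:: v + v] by apply: funext => -[|[|[|[|k]]]].
  apply => // k hk; apply: (@runs_seq _ _ _ 1 _ 4); first exact: runs_dec.
  apply: (@runs_seq _ _ _ 2 _ 2); first exact: runs_inc.
  have := @runs_inc tin tout tarr (nth 0 [:: (v - k.+1 + (v - k.+1)).+1; k]) 0.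
  congr (runs _ _ _ _).
    by apply: conf_eq => -[|[|[|[|i]]]].
  by apply: conf_eq => -[|[|[|[|i]]]] //; rewrite /upd /=; lia.
apply: (@runs_seq _ _ _ 3 (conf tin tout tarr (nth 0 [:: n %/ 2 ^ j])) 1).
  have hsc g : scanned (conf tin tout tarr g) 0 = cell_of (Bit (odd (n %/ 2 ^ j))).
    by rewrite -wdE.
  have [b [hb eb]] : exists b : bool, odd (n %/ 2 ^ j) = b /\ n %/ 2 ^ j = v + v + b.
    by exists (odd (n %/ 2 ^ j)).
  rewrite [in X in runs _ _ _ X]eb.
  apply: runs_if; rewrite hsc hb; case: b {hb eb} => //= _.
    have := runs_inc tin tout tarr (nth 0 [:: v + v]) 0.
    congr (runs _ _ _ _); apply: conf_eq => -[|[|[|[|i]]]] //.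
    by rewrite /upd /=; lia.
  by rewrite addn0; apply: runs_le (runs_skip _).
have := runs_go (conf tin tout tarr (nth 0 [:: n %/ 2 ^ j])) 0 MoveRight.
rewrite upd_conf_in; congr (runs _ _ _ (conf (_, _) _ _ _)) => /=; lia.
Qed.

Lemma start_confE (w : seq symbol) :
  start_conf w = conf (0%R, word_cells (map cell_of w)) (end_tape [::])
                   (table_tape [::]) (nth 0 [::]).
Proof.
apply: funext => -[|[|[|k]]] //=; rewrite /start_conf /upd /= nth_nil /reg_tape.
congr pair; apply: funext => -[i|i] //=; rewrite nth_nil.
by case: ifP => //; lia.
Qed.

Section TableMachine.
Variables (size_of : nat -> nat) (entry : nat * seq nat * nat -> nat).
Variables (bound : nat -> nat) (num den : run_context -> nat).
Hypothesis size_of_polytime : polytime run_context (fun x => size_of x.1).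
Hypothesis size_of_bounded : poly_bounded input_context size_of.
Hypothesis entry_polytime : polytime (extend run_context) entry.
Hypothesis bound_bounded : poly_bounded input_context bound.
Hypothesis entry_le : forall n a i, entry (n, a, i) <= bound n.
Hypothesis num_polytime : polytime run_context num.
Hypothesis den_polytime : polytime run_context den.

(** The interface to the analysis: it remains to supply a table whose entries depend on later
    entries, and two numbers computed from it. *)
Theorem table_machine : exists M k, forall n, exists2 t, t < (n + 2) ^ k &
  let x := (n, build_table size_of entry n 0) in
  outputs_within M (encode_nat n) (encode_nat (num x) ++ Comma :: encode_nat (den x)) t.
Proof.
have [p1 [c1 hc1 r1]] := runs_build_table size_of_polytime size_of_bounded
  entry_polytime bound_bounded entry_le.
have [p2 [c2 hc2 r2]] := runs_emit num_polytime.
have [p3 [c3 hc3 r3]] := runs_emit den_polytime.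
have [b2 hb2 cb2] := poly_bounded_build size_of_bounded bound_bounded entry_le hc2.
have [b3 hb3 cb3] := poly_bounded_build size_of_bounded bound_bounded entry_le hc3.
pose p := Seq read_input (Seq p1 (Seq p2 (Seq (write_cell 1 comma) p3))).
pose c (n : nat) := ((n + 1) * (10 * n + 9).+1).+1 + (c1 n + (b2 n + (1 + b3 n))).
have [k hk] : poly_bounded input_context (fun n => (c n).+1).
  have hn : poly_bounded input_context (fun n => n).
    by apply: poly_bounded_le (poly_bounded_size _) => n; rewrite input_context_size.
  have hcst := poly_bounded_const input_context.
  apply: poly_bounded_succ; apply: poly_bounded_add.
    apply: poly_bounded_succ; apply: poly_bounded_mul (poly_bounded_add hn (hcst 1)) _.
    exact: poly_bounded_succ (poly_bounded_add (poly_bounded_mul (hcst 10) hn) (hcst 9)).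
  apply: poly_bounded_add hc1 _; apply: poly_bounded_add hb2 _.
  exact: poly_bounded_add (hcst 1) hb3.
exists (machine p (max_tape p)), k => n.
set a := build_table size_of entry n 0.
have [tin h0] := runs_read_input n (end_tape [::]) (table_tape [::]).
have h2 := r2 n a tin [::].
have h3 := r3 n a tin (rcons (encode_nat (num (n, a))) Comma).
have hw := runs_act 1 (fun=> (comma, MoveRight))
  (conf tin (end_tape (map cell_of (encode_nat (num (n, a))))) (table_tape a) (nth 0 [:: n])).
rewrite upd_conf_out /= act_write_end -[comma]/(cell_of Comma) -map_rcons in hw.
have := runs_seq h0 (runs_seq (r1 n tin (end_tape [::])) (runs_seq h2 (runs_seq hw h3))).
move=> [t ht hr]; exists t.
  have hkn := hk n; rewrite input_context_size in hkn.
  apply: leq_trans hkn; rewrite ltnS; apply: leq_trans ht _; rewrite /c.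
  have := cb2 n 0 (leq0n _); have := cb3 n 0 (leq0n _); rewrite -/a => ? ?.
  apply: leq_add; last by lia.
  rewrite ltnS leq_mul2r; apply/orP; right; rewrite addn1 ltnS.
  case: (posnP n) => [->|hn]; first by rewrite trunc_log0.
  by apply: leq_trans (trunc_logP (ltnSn 1) hn); apply/ltnW/ltn_expl.
rewrite -start_confE in hr.
by apply: (run_outputs hr); rewrite /= cat_rcons.
Qed.

End TableMachine.

(** * Contraction of the tree recursion *)

Local Open Scope ring_scope.

(* The Bernstein coefficients on [1/2, 1] of the right-hand side are positive. *)
Lemma contraction_discriminant (R : realFieldType) (c : R) : 1 / 2 <= c <= 1 ->
  0 <= 9/10 + 9/10 * c ^+ 3 - 9 * (1 - c) * c ^+ 3 - (12 * c ^+ 3 - 29/20) ^+ 2 / 70.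
Proof.
move=> /andP[h1 h2].
have hz : 0 <= 2 * c - 1 by lra.
have hy : 0 <= 1 - c by lra.
have h k l : 0 <= (2 * c - 1) ^+ k * (1 - c) ^+ l.
  by rewrite mulr_ge0 ?exprn_ge0.
have := (h 0 6, h 1 5, h 2 4, h 3 3, h 4 2, h 5 1, h 6 0)%N.
move=> [[[[[[]]]]]].
lra.
Qed.


(** This is the inequality for three equal children of occupation probability [a]. As
    [s * m = (1 + s) ^+ 3 - 1], [u ^+ 3] is the product of the three factors [1 + w * a] of the
    general case, and a common factor [s] has been divided out of [u ^+ 3 - 1]. The difference of
    the sides is bounded below by a quadratic in [y = s * a]. *)
Lemma contraction_poly (R : realFieldType) (a s : R) : 0 <= a <= 1 / 2 -> 0 <= s <= 1 ->
  let m := 3 + 3 * s + s ^+ 2 in let u := 1 + s * m * a in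
  m * a * (1 - a) ^+ 3 * (u ^+ 2 + u + 1) <= 9/10 * (u ^+ 3 + (1 - a) ^+ 3).
Proof.
move=> /andP[a0 a1] /andP[s0 s1] /=.
set m := 3 + 3 * s + s ^+ 2; set u := 1 + s * m * a.
have hc : 1 / 2 <= 1 - a <= 1 by apply/andP; split; lra.
have := contraction_discriminant hc; rewrite subKr.
set w := (1 - a) ^+ 3 => hdisc.
have w0 : 0 <= w by rewrite exprn_ge0 //; lra.
(* The maximum of [a * (1 - a) ^+ 3], attained at 1/4, whence the double root. *)
have hX : a * w <= 27 / 256.
  have : 0 <= (4 * a - 1) ^+ 2 * ((4 * a - 5) ^+ 2 + 2).
    by rewrite mulr_ge0 ?sqr_ge0 // addr_ge0 ?sqr_ge0.
  by rewrite /w; lra.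
have X0 : 0 <= a * w by rewrite mulr_ge0.
have s2 : 0 <= s ^+ 2 by exact: sqr_ge0.
have s2s : s ^+ 2 <= s by rewrite expr2 ler_piMr.
pose d := s * m * a; pose y := s * a.
have y0 : 0 <= y by rewrite mulr_ge0.
have m3 : 3 <= m by rewrite /m; lra.
have m7 : m <= 7 by rewrite /m; lra.
have dy : 3 * y <= d.
  by have := ler_wpM2r y0 m3; rewrite /= /d /y; lra.
have hY : m * (a * w) <= 189 / 256.
  have : m * (a * w) <= 7 * (27 / 256) by rewrite ler_pM //; lra.
  by lra.
(* From [m <= 3 + 4 * s], as [s ^+ 2 <= s]. *)
have hYm : 3 * (m * (a * w)) <= 9 * (a * w) + 12 * (y * w).
  have : s ^+ 2 * (a * w) <= s * (a * w) by apply: ler_wpM2r.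
  by rewrite /m /y; lra.
have d0 : 0 <= d by lra.
have hYd : m * (a * w) * d <= 189 / 256 * d by apply: ler_wpM2r.
have hYdd : m * (a * w) * d ^+ 2 <= 189 / 256 * d ^+ 2 by apply: ler_wpM2r => //; exact: sqr_ge0.
have hdd : 9 * y ^+ 2 <= d ^+ 2.
  by have : (3 * y) ^+ 2 <= d ^+ 2; [rewrite ler_pXn2r ?nnegrE //; lra|lra].
(* The terms in [d] contribute at least [29/20 * y + 35/2 * y ^+ 2], since
   [3 * (27/10 - 3 * 189/256) > 29/20] and [9 * (27/10 - 189/256) > 35/2]. Completing the square
   against [- 12 * w * y] leaves the expression of [contraction_discriminant]. *)
have hsq : 0 <= (35 * y - (12 * w - 29/20)) ^+ 2 by exact: sqr_ge0.
have y2 : 0 <= y ^+ 2 by exact: sqr_ge0.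
have d3 : 0 <= d ^+ 3 by rewrite exprn_ge0.
have -> : u = 1 + d by [].
have -> : m * a * w * ((1 + d) ^+ 2 + (1 + d) + 1) =
  3 * (m * (a * w)) + 3 * (m * (a * w) * d) + m * (a * w) * d ^+ 2 by ring.
move: (m * (a * w)) (m * (a * w) * d) (m * (a * w) * d ^+ 2) hY hYm hYd hYdd
  => Y Yd Ydd hY hYm hYd hYdd.
lra.
Qed.

Lemma prod3_le_cube (R : realFieldType) (I : finType) (A : {pred I}) (E : I -> R) :
  #|A| = 3%N -> {in A, forall i, 0 <= E i} ->
  \prod_(i in A) E i <= ((\sum_(i in A) E i) / 3) ^+ 3.
Proof. by move=> hA hE; have := leif_AGM hE; rewrite hA => -[]. Qed.

(* [a i] is the probability that the [i]-th child is occupied. Replacing the children by three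
   copies of their average only weakens the contraction. *)
Lemma contraction_prod (R : realFieldType) (a : 'I_4 -> R) (s : R) (i0 : 'I_4) :
  0 <= s <= 1 -> (forall i, 0 <= a i <= 1 / 2) -> a i0 = 0 ->
  let w := (1 + s) ^+ 3 - 1 in
  let U := \prod_i (1 + w * a i) in let V := \prod_i (1 - a i) in
  (U - 1) * V <= 9/10 * s * (V + U).
Proof.
move=> hs ha a0 /=; have /andP[s0 s1] := hs.
set w := (1 + s) ^+ 3 - 1; set U := \prod_i (1 + w * a i); set V := \prod_i (1 - a i).
pose A := [pred i : 'I_4 | i != i0].
have cA : #|A| = 3%N by have := cardC1 i0; rewrite card_ord.
pose b := (\sum_(i in A) a i) / 3.
have hb : 0 <= b <= 1 / 2.
  have : 0 <= \sum_(i in A) a i by apply: sumr_ge0 => i _; case/andP: (ha i).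
  have : \sum_(i in A) a i <= \sum_(i in A) (1 / 2 : R).
    by apply: ler_sum => i _; case/andP: (ha i).
  rewrite sumr_const cA /b; lra.
pose m := 3 + 3 * s + s ^+ 2.
have wE : w = s * m by rewrite /w /m; ring.
have w0 : 0 <= w by rewrite wE /m mulr_ge0 ?addr_ge0 ?mulr_ge0 ?sqr_ge0.
have hU : U <= (1 + s * m * b) ^+ 3.
  rewrite /U (bigD1 i0) //= a0 mulr0 addr0 mul1r.
  apply: le_trans (prod3_le_cube cA _) _ => [i _|].
    by rewrite addr_ge0 // mulr_ge0 //; case/andP: (ha i).
  rewrite big_split /= sumr_const cA -mulr_sumr -wE /b.
  by rewrite le_eqVlt; apply/orP; left; apply/eqP; congr (_ ^+ 3); field.
have hV : V <= (1 - b) ^+ 3.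
  rewrite /V (bigD1 i0) //= a0 subr0 mul1r.
  apply: le_trans (prod3_le_cube cA _) _ => [i _|].
    by have /andP[] := ha i; lra.
  rewrite big_split /= sumr_const cA sumrN /b.
  by rewrite le_eqVlt; apply/orP; left; apply/eqP; congr (_ ^+ 3); field.
have U1 : 1 <= U.
  rewrite /U; elim/big_ind: _ => // [x y hx hy|i _]; first by rewrite mulr_ege1.
  by rewrite lerDl mulr_ge0 //; case/andP: (ha i).
have V0 : 0 <= V by apply: prodr_ge0 => i _; have /andP[] := ha i; lra.
have := contraction_poly hb hs; rewrite /= -/m.
set u := 1 + s * m * b in hU *; set C := (1 - b) ^+ 3 in hV * => hkey.
have hkey' : (u ^+ 3 - 1) * C <= 9/10 * s * (u ^+ 3 + C).
  have -> : (u ^+ 3 - 1) * C = s * (m * b * C * (u ^+ 2 + u + 1)) by rewrite /u; ring.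
  by have := ler_wpM2l s0 hkey; lra.
pose k := 9/10 * s; rewrite -/k in hkey' *.
have k0 : 0 <= k by rewrite /k; lra.
(* The claim reads [U * (V - k) <= V * (1 + k)]. It is clear if [V <= k]; otherwise it only gets
   harder when [U] is raised to [u ^+ 3]. The result, [V * (u ^+ 3 - 1 - k) <= k * u ^+ 3], is
   treated in the same way when [V] is raised to [C]. *)
case: (lerP V k) => hVk; first by nra.
have h1 : U * (V - k) <= u ^+ 3 * (V - k) by apply: ler_wpM2r => //; lra.
have u30 : 0 <= u ^+ 3 by lra.
case: (lerP (u ^+ 3 - 1 - k) 0) => h2; first by nra.
have h3 : V * (u ^+ 3 - 1 - k) <= C * (u ^+ 3 - 1 - k) by apply: ler_wpM2r => //; exact: ltW.
nra.
Qed.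

(** * Independent sets *)

Definition neighbour (v : site) (k : nat) : site :=
  match k with
  | 0%N => (v.1 + 1, v.2)
  | 1%N => (v.1, v.2 + 1)
  | 2%N => (v.1 - 1, v.2)
  | _ => (v.1, v.2 - 1)
  end.

Lemma adjacent_sitesP (u v : site) :
  adjacent_sites u v = has (fun k => v == neighbour u k) (iota 0 4).
Proof.
case: u v => [a b] [c d]; rewrite /adjacent_sites /= !xpair_eqE orbF.
by apply/idP/idP => h; lia.
Qed.

Lemma adjacent_sitesC (u v : site) : adjacent_sites u v = adjacent_sites v u.
Proof. by rewrite /adjacent_sites; congr (_ == _); lia. Qed.

Definition avoids (v : site) (j : nat) (u : site) : bool :=
  (u != v) && all (fun k => u != neighbour v k) (iota 0 j).

Lemma avoidsS (v : site) (j : nat) (u : site) :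
  avoids v j.+1 u = avoids v j u && (u != neighbour v j).
Proof. by rewrite /avoids -addn1 iotaD all_cat add0n /= andbT andbA. Qed.

Lemma avoids4 (v u : site) : avoids v 4 u = (u != v) && ~~ adjacent_sites v u.
Proof. by rewrite adjacent_sitesP -all_predC. Qed.

Definition independent (A : {fset int * int}) : bool :=
  [forall u : A, forall v : A, ~~ adjacent_sites (val u) (val v)].

Lemma independentP (A : {fset int * int}) :
  reflect {in A &, forall u v, ~~ adjacent_sites u v} (independent A).
Proof.
apply: (iffP idP) => [/forallP h u v hu hv|h].
  by have /forallP/(_ [` hv]%fset) := h [` hu]%fset.
by apply/forallP => u; apply/forallP => v; apply: h; apply: valP.
Qed.

Definition independent_sets (G : {fset int * int}) : {fset {fset int * int}} :=
  [fset A in fpowerset G | independent A]%fset.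

Lemma independent_setsP (G A : {fset int * int}) :
  (A \in independent_sets G) = (A `<=` G)%fset && independent A.
Proof. by rewrite !inE fpowersetE. Qed.

Definition partition_function (G : {fset int * int}) : nat := #|` independent_sets G|.

Definition cut_fset (G : {fset int * int}) (v : site) (j : nat) : {fset int * int} :=
  [fset u in G | avoids v j u]%fset.

Lemma mem_cut_fset G v j u : (u \in cut_fset G v j) = (u \in G) && avoids v j u.
Proof. by rewrite !inE. Qed.

Lemma cut_fset0 G v : cut_fset G v 0 = (G `\ v)%fset.
Proof. by apply/fsetP => u; rewrite !inE /avoids andbT andbC. Qed.

Lemma cut_fsetS G v j : cut_fset G v j.+1 = (cut_fset G v j `\ neighbour v j)%fset.
Proof. by apply/fsetP => u; rewrite !inE avoidsS andbA andbC. Qed.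

Lemma partition_function_gt0 G : (0 < partition_function G)%N.
Proof.
rewrite cardfs_gt0; apply/fset0Pn; exists fset0.
by rewrite independent_setsP fsub0set; apply/independentP => u v; rewrite inE.
Qed.

Lemma partition_function_rec (G : {fset int * int}) (v : site) : v \in G ->
  partition_function G =
  (partition_function (G `\ v)%fset + partition_function (cut_fset G v 4))%N.
Proof.
move=> vG; pose f (A : {fset int * int}) := (v |` A)%fset.
have notin A : A \in independent_sets (cut_fset G v 4) -> v \notin A.
  rewrite independent_setsP => /andP[/fsubsetP h _]; apply/negP => /h.
  by rewrite mem_cut_fset /avoids eqxx andbF.
have finj : {in independent_sets (cut_fset G v 4) &, injective f}.
  move=> A B /notin hA /notin hB e.
  by rewrite -(fsetU1K hA) -(fsetU1K hB) -/(f A) e.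
have hc : #|` (f @` independent_sets (cut_fset G v 4))%fset| = partition_function (cut_fset G v 4).
  by rewrite card_in_imfset //=.
rewrite -hc /partition_function -cardfsUI.
set S := (_ `&` _)%fset; have -> : S = fset0.
  apply/fsetP => A; rewrite !inE; apply/negP => /andP[/andP[hA _]].
  move=> /imfsetP[/= B _ e]; move: hA; rewrite fpowersetE => /fsubsetP/(_ v).
  by rewrite e !inE eqxx => /(_ isT).
rewrite cardfs0 addn0; congr #|` _|; apply/fsetP => A.
rewrite in_fsetU !independent_setsP; apply/idP/orP.
- move=> /andP[AG iA]; case: (boolP (v \in A)) => vA; last first.
    left; rewrite iA andbT; apply/fsubsetP => u uA; rewrite !inE.
    by rewrite (fsubsetP AG) // andbT; apply: contraNneq vA => <-.
  right; apply/imfsetP; exists (A `\ v)%fset; last by rewrite /f fsetD1K.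
  rewrite /= independent_setsP; apply/andP; split.
    apply/fsubsetP => u; rewrite mem_cut_fset avoids4 !inE => /andP[-> uA].
    by rewrite (fsubsetP AG) //=; move/independentP: iA; apply.
  apply/independentP => u w; rewrite !inE => /andP[_ hu] /andP[_ hw].
  by move/independentP: iA; apply.
- case=> [/andP[AG ->]|/imfsetP[/= B]].
    by rewrite andbT; apply: fsubset_trans AG (fsubD1set _ _).
  rewrite independent_setsP => /andP[/fsubsetP BG iB] ->; apply/andP; split.
    by rewrite /f fsubUset fsub1set vG; apply/fsubsetP => u /BG; rewrite mem_cut_fset => /andP[].
  have hv u : u \in B -> ~~ adjacent_sites v u.
    by move=> /BG; rewrite mem_cut_fset avoids4 => /and3P[].
  apply/independentP => u w; rewrite !inE => /orP[/eqP->|hu] /orP[/eqP->|hw].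
  + by rewrite /adjacent_sites !subrr.
  + exact: hv.
  + by rewrite adjacent_sitesC; exact: hv.
  + by move/independentP: iB; apply.
Qed.

(** * Vacancy probabilities and their recursion *)

Section Vacancy.
Variable R : realFieldType.

Definition vacancy (G : {fset int * int}) (v : site) : R :=
  (partition_function (G `\ v)%fset)%:R / (partition_function G)%:R.

Lemma vacancy_notin G v : v \notin G -> vacancy G v = 1.
Proof.
move=> h; rewrite /vacancy (_ : (G `\ v)%fset = G) ?divff //.
  by rewrite pnatr_eq0 -lt0n partition_function_gt0.
by apply/fsetP => u; rewrite !inE; case: eqP => // ->; rewrite (negbTE h).
Qed.

(** The [j]-th factor is the ratio of the partition functions of two successive cuts, so the product
    telescopes to the ratio of the sets with [v] occupied to those with [v] vacant. *)
Lemma vacancy_rec G v : v \in G ->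
  vacancy G v = (1 + \prod_(j < 4) vacancy (cut_fset G v j) (neighbour v j))^-1.
Proof.
have Z0 H : (partition_function H)%:R != 0 :> R.
  by rewrite pnatr_eq0 -lt0n partition_function_gt0.
move=> vG; have -> : \prod_(j < 4) vacancy (cut_fset G v j) (neighbour v j) =
    (partition_function (cut_fset G v 4))%:R / (partition_function (cut_fset G v 0))%:R.
  elim: 4%N => [|n IH]; first by rewrite big_ord0 divff.
  rewrite big_ord_recr /= IH /vacancy -cut_fsetS mulrC.
  by rewrite mulrA divfK.
rewrite cut_fset0 /vacancy (partition_function_rec vG) natrD.
have := Z0 (G `\ v)%fset; have := Z0 (cut_fset G v 4); have := Z0 G.
rewrite (partition_function_rec vG) natrD => ? ? ?.
by field; apply/andP; split.
Qed.

End Vacancy.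

(** The graph seen by the [j]-th child: its parent and its elder siblings are gone. Deleting the
    neighbours in a fixed order keeps the recursion exact although the grid has cycles. *)
Definition cut_region (g : pred site) (v : site) (j : nat) : pred site :=
  fun u => g u && avoids v j u.

Definition opposite (k : 'I_4) : 'I_4 := inord ((k + 2) %% 4).

Lemma neighbour_opposite (v : site) (k : 'I_4) :
  neighbour (neighbour v k) (opposite k) = v.
Proof.
rewrite /opposite inordK ?ltn_mod //.
by case: v k => [a b] [[|[|[|[|]]]]] //= _; congr pair; lia.
Qed.

Lemma cut_region_self (g : pred site) (v : site) (j : nat) : ~~ cut_region g v j v.
Proof. by rewrite /cut_region /avoids eqxx andbF. Qed.

(** * Two levels of the recursion *)

Section Contraction.
Variable R : realFieldType.
Implicit Types (x y : 'I_4 -> R) (s : R).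

Fixpoint tree_value (d : nat) (g : pred site) (v : site) : R :=
  if d is d'.+1 then
    if g v then (1 + \prod_(j < 4) tree_value d' (cut_region g v j) (neighbour v j))^-1 else 1
  else 1.

Lemma prod_itv01 x : (forall j, 0 <= x j <= 1) -> 0 <= \prod_j x j <= 1.
Proof.
move=> hx; rewrite prodr_ge0 /=; last by move=> j _; case/andP: (hx j).
by apply: prodr_ile1 => j _; exact: hx.
Qed.

Lemma inv_1D_itv (P : R) : 0 <= P <= 1 -> 1 / 2 <= (1 + P)^-1 <= 1.
Proof.
move=> /andP[h0 h1]; have hp : 0 < 1 + P by lra.
by rewrite div1r lef_pV2 ?posrE ?ltr0n // invf_le1 //; apply/andP; split; lra.
Qed.

Lemma vacancy_itv (G : {fset int * int}) (v : site) : 1 / 2 <= vacancy R G v <= 1.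
Proof.
have h0 H u : 0 <= vacancy R H u by rewrite divr_ge0 ?ler0n.
have h1 H u : vacancy R H u <= 1.
  case: (boolP (u \in H)) => hu; last by rewrite vacancy_notin.
  rewrite vacancy_rec //; set P := \prod_(_ < _) _.
  have hP : 0 <= P by apply: prodr_ge0.
  by rewrite invf_le1; lra.
case: (boolP (v \in G)) => hv; last by rewrite vacancy_notin //; lra.
rewrite vacancy_rec //; apply/inv_1D_itv/prod_itv01 => j.
by rewrite h0 h1.
Qed.

Lemma tree_value_itv d g v : 1 / 2 <= tree_value d g v <= 1.
Proof.
elim: d g v => [|d IH] g v /=; first by lra.
case: ifP => _; last by lra.
by apply/inv_1D_itv/prod_itv01 => j; have /andP[] := IH (cut_region g v j) (neighbour v j); lra.
Qed.

Definition ratio_close (s : R) (x y : R) : bool := (x <= (1 + s) * y) && (y <= (1 + s) * x).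

Lemma ratio_closeC s (x y : R) : ratio_close s x y = ratio_close s y x.
Proof. exact: andbC. Qed.

(** With one factor [y i0 = 1] only three ratios accumulate, so the product grows by at most
    [(1 + s) ^+ 3]. The inverse then moves in proportion to [Q / (1 + Q)], which is the occupation
    probability [1 - (1 + Q)^-1]; keeping this weight is what makes the next level contract. *)
Lemma child_step x y s (i0 : 'I_4) : 0 <= s ->
  (forall j, 0 <= x j <= 1) -> (forall j, 0 <= y j <= 1) ->
  (forall j, x j <= (1 + s) * y j) -> y i0 = 1 ->
  (1 + \prod_j y j)^-1 <=
  (1 + \prod_j x j)^-1 * (1 + ((1 + s) ^+ 3 - 1) * (1 - (1 + \prod_j y j)^-1)).
Proof.
move=> s0 hx hy hxy y1.
have hP : \prod_j x j <= (1 + s) ^+ 3 * \prod_j y j.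
  rewrite (bigD1 i0) //= [in leRHS](bigD1 i0) //= y1 mul1r.
  apply: (@le_trans _ _ (\prod_(i < 4 | i != i0) x i)).
    apply: ler_piMl; last by case/andP: (hx i0).
    by apply: prodr_ge0 => j _; case/andP: (hx j).
  have -> : (1 + s) ^+ 3 = \prod_(i < 4 | i != i0) (1 + s).
    by rewrite prodr_const; congr (_ ^+ _); have := cardC1 i0; rewrite card_ord.
  rewrite -big_split /=; apply: ler_prod => j _.
  by rewrite hxy andbT; case/andP: (hx j).
have /andP[P0 P1] := prod_itv01 hx; have /andP[Q0 Q1] := prod_itv01 hy.
move: (\prod_j x j) (\prod_j y j) hP P0 P1 Q0 Q1 => P Q hP P0 P1 Q0 Q1.
have -> : 1 - (1 + Q)^-1 = Q / (1 + Q) by field; lra.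
rewrite ler_pdivlMl ?ler_pdivrMr; try lra.
have -> : (1 + ((1 + s) ^+ 3 - 1) * (Q / (1 + Q))) * (1 + Q) = 1 + (1 + s) ^+ 3 * Q.
  by field; lra.
lra.
Qed.

(** Multiplying the hypotheses gives [V <= X * U], where [X] and [V] are the two products and [U]
    collects the weighted errors; [contraction_prod] bounds [(U - 1) * V], which is what the
    comparison of [1 + V] with [1 + X] requires. *)
Lemma parent_step x y s (i0 : 'I_4) : 0 <= s <= 1 ->
  (forall j, 0 <= x j) -> (forall j, 1 / 2 <= y j <= 1) ->
  (forall j, y j <= x j * (1 + ((1 + s) ^+ 3 - 1) * (1 - y j))) -> y i0 = 1 ->
  (1 + \prod_j x j)^-1 <= (1 + 9/10 * s) * (1 + \prod_j y j)^-1.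
Proof.
move=> hs hx hy hxy y1; have /andP[s0 s1] := hs.
set w := (1 + s) ^+ 3 - 1 in hxy.
have w0 : 0 <= w by rewrite subr_ge0 exprn_ege1 // lerDl.
have ha i : 0 <= 1 - y i <= 1 / 2 by have /andP[] := hy i; lra.
have a0 : 1 - y i0 = 0 by rewrite y1 subrr.
have := contraction_prod hs ha a0; rewrite /= -/w.
have -> : \prod_i (1 - (1 - y i)) = \prod_i y i by apply: eq_bigr => i _; rewrite subKr.
set U := \prod_i (1 + w * (1 - y i)); set V := \prod_i y i => hUV.
have hV : V <= (\prod_i x i) * U.
  rewrite -big_split /=; apply: ler_prod => i _; rewrite hxy andbT.
  by have /andP[] := hy i; lra.
have U0 : 0 < U.
  apply: prodr_gt0 => i _; apply: ltr_wpDr => //; apply: mulr_ge0 => //.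
  by case/andP: (ha i).
have V0 : 0 <= V by apply: prodr_ge0 => i _; have /andP[] := hy i; lra.
have X0 : 0 <= \prod_i x i by apply: prodr_ge0.
move: (\prod_i x i) hV X0 => X hV X0.
have hX1 : 0 < 1 + X by lra.
have hV1 : 0 < 1 + V by lra.
rewrite -[(1 + X)^-1]mul1r ler_pdivrMr // mulrAC ler_pdivlMr // mul1r.
rewrite -(ler_pM2r U0).
have : 9/10 * s * V <= 9/10 * s * (X * U) by apply: ler_wpM2l => //; lra.
lra.
Qed.

Lemma ratio_close_step x y s (i0 : 'I_4) : 0 <= s <= 1 ->
  (forall j, 1 / 2 <= x j <= 1) -> (forall j, 1 / 2 <= y j <= 1) ->
  (forall j, y j <= x j * (1 + ((1 + s) ^+ 3 - 1) * (1 - y j))) ->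
  (forall j, x j <= y j * (1 + ((1 + s) ^+ 3 - 1) * (1 - x j))) ->
  x i0 = 1 -> y i0 = 1 ->
  ratio_close (9/10 * s) (1 + \prod_j x j)^-1 (1 + \prod_j y j)^-1.
Proof.
move=> hs hx hy hyx hxy x1 y1; apply/andP; split.
  by apply: (parent_step hs _ hy hyx y1) => j; have /andP[] := hx j; lra.
by apply: (parent_step hs _ hx hxy x1) => j; have /andP[] := hy j; lra.
Qed.

(** Induction by two levels. Below the root the direction leading back to the parent is always dead;
    at the root a dead neighbour has to be assumed. *)
Lemma vacancy_tree_value e (G : {fset int * int}) (g : pred site) (v : site) :
  (forall u, (u \in G) = g u) -> (exists k : 'I_4, ~~ g (neighbour v k)) ->
  ratio_close ((9/10) ^+ e) (tree_value (2 * e) g v) (vacancy R G v).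
Proof.
have cutE H f u j : (forall z, (z \in H) = f z) ->
    forall z, (z \in cut_fset H u j) = cut_region f u j z.
  by move=> h z; rewrite mem_cut_fset h.
elim: e G g v => [|e IH] G g v hG [k hk].
  (* At depth 0 the tree value is 1, and numbers in [1/2, 1] are within a factor 2, that is, close
     with [s = 1]. *)
  have /andP[h1 h2] := vacancy_itv G v.
  by rewrite muln0 expr0 /ratio_close /=; apply/andP; split; lra.
have hs : 0 <= (9/10 : R) ^+ e <= 1.
  by apply/andP; split; [apply: exprn_ge0|apply: exprn_ile1]; lra.
have s0 : (0 : R) <= (9/10) ^+ e by case/andP: hs.
have s1 : (0 : R) <= (9/10) ^+ e.+1 by apply: exprn_ge0; lra.
rewrite mulnS add2n; case: (boolP (g v)) => hv; last first.
  by rewrite vacancy_notin ?hG // /= (negbTE hv) /ratio_close; apply/andP; split; lra.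
rewrite vacancy_rec ?hG //.
change (tree_value (2 * e).+2 g v) with
  (if g v then
     (1 + \prod_(j < 4) tree_value (2 * e).+1 (cut_region g v j) (neighbour v j))^-1 else 1).
rewrite hv exprS.
have dead (d : nat) H f u : (forall z, (z \in H) = f z) -> ~~ f u ->
    tree_value d f u = 1 /\ vacancy R H u = 1.
  by move=> h hu; split; [case: d => //= d; rewrite (negbTE hu)|rewrite vacancy_notin ?h].
have hk' : ~~ cut_region g v k (neighbour v k) by rewrite /cut_region negb_and hk.
have [d1 d2] := dead (2 * e).+1 _ _ _ (cutE _ _ v k hG) hk'.
apply: (ratio_close_step (i0 := k)) => // [j|j|j|j];
  try exact: tree_value_itv; try exact: vacancy_itv.
all: set f := cut_region g v j; set H := cut_fset G v j; set u := neighbour v j.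
all: have hH : forall z, (z \in H) = f z by apply: cutE.
all: case: (boolP (f u)) => hu;
  last by (have [-> ->] := dead (2 * e).+1 _ _ _ hH hu; rewrite subrr mulr0 addr0 mulr1).
all: rewrite vacancy_rec ?hH //= hu.
all: have hi : forall i : 'I_4, ratio_close ((9/10) ^+ e)
    (tree_value (2 * e) (cut_region f u i) (neighbour u i))
    (vacancy R (cut_fset H u i) (neighbour u i))
  by (move=> i; apply: (IH _ _ _ (cutE _ _ _ _ hH)); exists (opposite i);
      rewrite neighbour_opposite; exact: cut_region_self).
(* Seen from the child [u], the opposite of direction [j] is [v], which the first cut removed. *)
all: have hv' : ~~ cut_region f u (opposite j) (neighbour u (opposite j))
  by rewrite neighbour_opposite /cut_region /f (negbTE (cut_region_self _ _ _)).
all: have [e1 e2] := dead (2 * e)%N _ _ _ (cutE _ _ u (opposite j) hH) hv'.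
all: have ha (i : 'I_4) : 0 <= tree_value (2 * e) (cut_region f u i) (neighbour u i) <= 1
  by (have /andP[] := tree_value_itv (2 * e) (cut_region f u i) (neighbour u i); lra).
all: have hb (i : 'I_4) : 0 <= vacancy R (cut_fset H u i) (neighbour u i) <= 1
  by (have /andP[] := vacancy_itv (cut_fset H u i) (neighbour u i); lra).
all: apply: (child_step (i0 := opposite j) s0) => // i.
all: by case/andP: (hi i).
Qed.

End Contraction.

(** * Entropy of the hard square shift *)

Definition translate (v t : site) : site := (v.1 + t.1, v.2 + t.2).

Lemma translate0 (v : site) : translate v (0, 0) = v.
Proof. by case: v => a b; rewrite /translate /= !addr0. Qed.

Lemma neighbour_translate (v t : site) (k : nat) :
  neighbour (translate v t) k = translate v (neighbour t k).
Proof. by case: v t => a b [c d]; case: k => [|[|[|k]]]; congr pair => /=; lia. Qed.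

Lemma translate_inj (v : site) : injective (translate v).
Proof. by case: v => a b [c d] [c' d'] [h1 h2]; congr pair; lia. Qed.

Lemma avoids_translate (v t u : site) (j : nat) :
  avoids (translate v t) j (translate v u) = avoids t j u.
Proof.
rewrite /avoids (inj_eq (@translate_inj v)); congr (_ && _).
by apply: eq_all => k; rewrite neighbour_translate (inj_eq (@translate_inj v)).
Qed.

Definition in_box (d : nat) (t : site) : bool := (`|t.1| <= d%:Z) && (`|t.2| <= d%:Z).

Lemma in_box_neighbour (d : nat) (t : site) (j : nat) :
  in_box d t -> in_box d.+1 (neighbour t j).
Proof.
by case: t => a b; rewrite /in_box; case: j => [|[|[|j]]] /= => h; lia.
Qed.

(** A path of length [d] starting in the box of radius [n] stays in the box of radius [d + n];
    cutting depends only on relative positions. *)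
Lemma tree_value_local (R : realFieldType) d n (g g' : pred site) (v v' t : site) :
  (forall u, in_box (d + n) u -> g (translate v u) = g' (translate v' u)) -> in_box n t ->
  tree_value R d g (translate v t) = tree_value R d g' (translate v' t).
Proof.
elim: d n g g' t => [|d IH] n g g' t hg ht //=.
rewrite hg; last by move: ht; rewrite /in_box; lia.
case: ifP => // _; congr (_^-1); congr (1 + _); apply: eq_bigr => j _.
rewrite !neighbour_translate; apply: (IH n.+1); last exact: in_box_neighbour.
by move=> u hu; rewrite /cut_region hg ?avoids_translate // addSnnS.
Qed.

(** What is left around a site, placed at the origin, of the whole lattice once the sites preceding
    it in the order of deletion are gone. *)
Definition root_region : pred site := fun u => (0 < u.2) || ((u.2 == 0) && (0 <= u.1)).

Definition root_value (R : realFieldType) (d : nat) : R := tree_value R d root_region (0, 0).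

(** * Deleting the sites of a rectangle row by row *)

Section Rectangle.
Variables (j1 j2 : nat).

Lemma mem_rectangle (u : site) :
  (u \in rectangle j1 j2) = (1 <= u.1 <= j1%:Z) && (1 <= u.2 <= j2%:Z).
Proof.
apply/imfset2P/idP => [[a /= ha [b /= hb ->]]|] /=.
  by move: ha hb; rewrite !mem_iota; lia.
case: u => [[a|a] [b|b]] /= => h; try lia.
by exists a; [|exists b]; rewrite //= mem_iota; lia.
Qed.

Definition site_of (x y : nat) : site := (Posz x.+1, Posz y.+1).

Definition rank (u : site) : nat := ((`|u.2|.-1) * j1 + `|u.1|.-1)%N.

Definition remaining (k : nat) : {fset int * int} :=
  [fset u in rectangle j1 j2 | (k <= rank u)%N]%fset.

Lemma mem_remaining k u : (u \in remaining k) = (u \in rectangle j1 j2) && (k <= rank u)%N.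
Proof. by rewrite !inE. Qed.

Lemma remaining0 : remaining 0 = rectangle j1 j2.
Proof. by apply/fsetP => u; rewrite mem_remaining andbT. Qed.

Lemma remaining_end : remaining (j2 * j1) = fset0.
Proof.
apply/fsetP => u; rewrite mem_remaining mem_rectangle inE /rank.
case: u => [[a|a] [b|b]] //=; apply/negbTE/negP => /andP[h1]; nia.
Qed.

Lemma remainingS x y : (x < j1)%N -> (y < j2)%N ->
  remaining (y * j1 + x).+1 = (remaining (y * j1 + x) `\ site_of x y)%fset.
Proof.
move=> hx hy; apply/fsetP => u; rewrite !inE !mem_rectangle /rank.
case: u => [[a|a] [b|b]] /=; rewrite ?xpair_eqE ?andbF //=.
apply/idP/idP => [/andP[h1 h2]|/andP[h0 /andP[h1 h2]]].
  by apply/and3P; split => //; [apply/negP => /andP[/eqP[e1] /eqP[e2]]; subst; lia|lia].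
apply/andP; split => //; rewrite ltn_neqAle h2 andbT.
apply: contra h0 => /eqP e; rewrite !eqz_nat.
have e1 : b.-1 = y by move: h1 e; nia.
by move: e; rewrite e1; lia.
Qed.

(** The left neighbour either has the preceding rank or lies outside the rectangle; it provides the
    dead child at the root. *)
Lemma remaining_dead x y : ~~ (neighbour (site_of x y) 2 \in remaining (y * j1 + x)).
Proof.
rewrite mem_remaining mem_rectangle /rank /=; apply/negP => /andP[h1 h2].
have e : (`|(Posz x.+1 - 1)%R|.-1 = x.-1)%N by lia.
by move: h1 h2; rewrite e; lia.
Qed.

(** There is no margin towards the bottom: the rows below are deleted already, just as in
    [root_region]. *)
Definition inner_site (d x y : nat) : bool := [&& d <= x, x + d < j1 & y + d < j2]%N.

Lemma remaining_inner d x y u : inner_site d x y -> in_box d u ->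
  (translate (site_of x y) u \in remaining (y * j1 + x)) = root_region u.
Proof.
rewrite /inner_site /in_box mem_remaining mem_rectangle /rank /root_region => /and3P[h1 h2 h3].
case: u => a b /= /andP[ha hb].
case: (ltrgtP b 0) => hb0 /=.
- apply/negbTE/negP => /andP[/andP[_ /andP[h4 _]]] h5.
  have : (`|(Posz y.+1 + b)%R|.-1.+1 <= y)%N by lia.
  move=> h6; have : (`|(Posz y.+1 + b)%R|.-1.+1 * j1 <= y * j1)%N by rewrite leq_mul2r h6 orbT.
  have : (`|(Posz x.+1 + a)%R|.-1 < j1)%N by lia.
  by lia.
- have : (y.+1 <= `|(Posz y.+1 + b)%R|.-1)%N by lia.
  move=> h6; have : (y.+1 * j1 <= `|(Posz y.+1 + b)%R|.-1 * j1)%N by rewrite leq_mul2r h6 orbT.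
  by lia.
- by rewrite hb0 addr0 /=; apply/idP/idP; lia.
Qed.

End Rectangle.

Local Open Scope classical_set_scope.

(** Any independent subset of [S] extends by zeros to a point of the shift, so globally and locally
    admissible patterns coincide. *)
Lemma card_language (S : {fset int * int}) :
  #|language hard_square_shift S| = partition_function S.
Proof.
pose g (A : {fset int * int}) : {ffun S -> bool} := [ffun s => val s \in A].
have ginj : {in independent_sets S &, injective g}.
  move=> A B; rewrite !independent_setsP => /andP[/fsubsetP hA _] /andP[/fsubsetP hB _] e.
  have h u (uS : u \in S) : (u \in A) = (u \in B).
    by have /ffunP/(_ [` uS]%fset) := e; rewrite !ffunE.
  by apply/fsetP => u; apply/idP/idP => hu; [rewrite -h ?hA|rewrite h ?hB].
have -> : partition_function S = #|` (g @` independent_sets S)%fset|.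
  by rewrite card_in_imfset.
have -> : (g @` independent_sets S)%fset = [fset w in language hard_square_shift S]%fset.
  apply/fsetP => w; rewrite !inE; apply/imfsetP/idP => [[A /= hA ->]|].
    move: hA; rewrite independent_setsP => /andP[/fsubsetP hA /independentP iA].
    apply/asboolP; exists (fun u => u \in A); last by move=> s; rewrite ffunE.
    move=> u v /= huv; apply/negP => /andP[hu hv].
    by have := iA u v hu hv; rewrite huv.
  move/asboolP => -[x hx hw].
  exists [fset u in S | x u]%fset; last first.
    by apply/ffunP => s; rewrite ffunE !inE hw (valP s).
  rewrite /= independent_setsP; apply/andP; split.
    by apply/fsubsetP => u; rewrite !inE => /andP[].
  apply/independentP => u v; rewrite !inE => /andP[_ hu] /andP[_ hv].
  by apply/negP => huv; have := hx u v huv; rewrite hu hv.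
by rewrite card_finset.
Qed.

(** * From vacancies to the entropy *)

Section Entropy.
Variable R : realType.

Lemma close_ln (s x y : R) : 0 <= s -> 0 < x -> 0 < y -> ratio_close s x y ->
  `|ln x - ln y| <= s.
Proof.
move=> s0 x0 y0 /andP[h1 h2].
have s1 : 0 < 1 + s by lra.
have hs : ln (1 + s) <= s by apply: le_ln1Dx; lra.
have e1 : ln x <= ln (1 + s) + ln y.
  by rewrite -lnM ?posrE // ler_ln ?posrE // mulr_gt0.
have e2 : ln y <= ln (1 + s) + ln x.
  by rewrite -lnM ?posrE // ler_ln ?posrE // mulr_gt0.
by rewrite ler_norml; apply/andP; split; lra.
Qed.

Lemma ln_half_itv (x : R) : 1 / 2 <= x <= 1 -> -1 <= ln x <= 0.
Proof.
move=> /andP[h1 h2]; have x0 : 0 < x by lra.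
apply/andP; split; last by apply: ln_le0.
have : ln (1 + (x^-1 - 1)) <= x^-1 - 1.
  by apply: le_ln1Dx; have : 0 < x^-1 by [rewrite invr_gt0]; lra.
rewrite addrCA subrr addr0 lnV ?posrE //.
have : x^-1 <= 2 by rewrite invf_ple ?posrE //; lra.
lra.
Qed.

(** Each vacancy is the ratio of two successive partition functions in the order of deletion; the
    logarithms telescope, and the empty graph contributes [ln 1]. *)
Lemma ln_partition_function (j1 j2 : nat) :
  ln (partition_function (rectangle j1 j2))%:R =
  \sum_(y < j2) \sum_(x < j1)
    - ln (vacancy R (remaining j1 j2 (y * j1 + x)) (site_of x y)) :> R.
Proof.
have Z0 H : (0 : R) < (partition_function H)%:R by rewrite ltr0n partition_function_gt0.
have step x y : (x < j1)%N -> (y < j2)%N ->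
    - ln (vacancy R (remaining j1 j2 (y * j1 + x)) (site_of x y)) =
    ln (partition_function (remaining j1 j2 (y * j1 + x)))%:R -
    ln (partition_function (remaining j1 j2 (y * j1 + x).+1))%:R.
  by move=> hx hy; rewrite /vacancy -remainingS // ln_div ?posrE // opprB.
pose L k : R := ln (partition_function (remaining j1 j2 k))%:R.
have row y : (y < j2)%N -> \sum_(x < j1)
    - ln (vacancy R (remaining j1 j2 (y * j1 + x)) (site_of x y)) = L (y * j1)%N - L (y.+1 * j1)%N.
  move=> hy; rewrite (eq_bigr (fun x : 'I_j1 => L (y * j1 + x)%N - L (y * j1 + x).+1)); last first.
    by move=> x _; rewrite step.
  rewrite -(big_mkord xpredT (fun x => L (y * j1 + x)%N - L (y * j1 + x).+1)).
  rewrite (eq_bigr (fun x => - (L (y * j1 + x.+1)%N - L (y * j1 + x)%N))); last first.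
    by move=> x _; rewrite opprB addnS.
  by rewrite sumrN telescope_sumr // opprB addn0 mulSn addnC.
rewrite (eq_bigr (fun y : 'I_j2 => - (L (y.+1 * j1)%N - L (y * j1)%N))); last first.
  by move=> y _; rewrite row // opprB.
rewrite sumrN -(big_mkord xpredT (fun y => L (y.+1 * j1)%N - L (y * j1)%N)).
rewrite (telescope_sumr (fun y => L (y * j1)%N)) // opprB mul0n /L remaining0 remaining_end.
suff -> : partition_function fset0 = 1%N by rewrite ln1 subr0.
rewrite /partition_function (_ : independent_sets fset0 = [fset fset0]%fset) ?cardfs1 //.
apply/fsetP => A; rewrite independent_setsP inE fsubset0.
case: eqP => // ->; apply/independentP => u v; by rewrite inE.
Qed.

Lemma root_value_itv d : 1 / 2 <= root_value R d <= 1.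
Proof. exact: tree_value_itv. Qed.

Lemma vacancy_inner (e j1 j2 x y : nat) : inner_site j1 j2 (2 * e) x y ->
  `|ln (vacancy R (remaining j1 j2 (y * j1 + x)) (site_of x y)) - ln (root_value R (2 * e))|
    <= (9/10) ^+ e.
Proof.
move=> hi; set G := remaining _ _ _; set v := site_of x y.
have := @vacancy_tree_value R e G (fun u => u \in G) v (fun=> erefl).
have hd : exists k : 'I_4, ~~ (neighbour v k \in G).
  by exists (inord 2); rewrite inordK //; exact: remaining_dead.
move=> /(_ hd).
have -> : tree_value R (2 * e) (fun u => u \in G) v = root_value R (2 * e).
  rewrite -[v]translate0 /root_value -[X in _ = tree_value _ _ _ X](translate0 (0, 0)).
  apply: (@tree_value_local R (2 * e) 0); last by rewrite /in_box.
  move=> u; rewrite addn0 => hu.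
  have -> : translate (0, 0) u = u by case: u {hu} => a b; rewrite /translate /= !add0r.
  exact: (remaining_inner hi hu).
rewrite ratio_closeC => /close_ln; apply.
- by rewrite exprn_ge0.
- by have /andP[] := vacancy_itv R G v; lra.
- by have /andP[] := root_value_itv (2 * e); lra.
Qed.

(** Near the boundary both logarithms lie in [-1, 0], so the error is at most 1; the natural number
    on the right is at least 1 at such sites. *)
Lemma vacancy_near (e j1 j2 x y : nat) : (x < j1)%N -> (y < j2)%N ->
  let d := (2 * e)%N in
  `|- ln (vacancy R (remaining j1 j2 (y * j1 + x)) (site_of x y)) + ln (root_value R d)| <=
  (9/10) ^+ e + ((x < d) + (j1 - d <= x) + (j2 - d <= y))%N%:R.
Proof.
move=> hx hy /=; set d := (2 * e)%N; rewrite addrC distrC.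
have k0 : (0 : R) <= (9/10) ^+ e by rewrite exprn_ge0.
case: (boolP (inner_site j1 j2 d x y)) => hi.
  apply: le_trans (vacancy_inner hi) _.
  by rewrite lerDl.
have : (1 <= (x < d) + (j1 - d <= x) + (j2 - d <= y))%N.
  by move: hi; rewrite /inner_site; lia.
rewrite -(ler_nat R) => h1.
have /ln_half_itv/andP[h2 h3] := vacancy_itv R (remaining j1 j2 (y * j1 + x)) (site_of x y).
have /ln_half_itv/andP[h4 h5] := root_value_itv d.
apply: (@le_trans _ _ 1); last by lra.
by rewrite ler_norml; apply/andP; split; lra.
Qed.

Lemma boundary_count (d j1 j2 : nat) :
  (\sum_(y < j2) \sum_(x < j1) ((x < d) + (j1 - d <= x) + (j2 - d <= y)) <=
   2 * d * j2 + d * j1)%N.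
Proof.
have hi n : (\sum_(x < n) (n - d <= x) <= d)%N.
  have h : (\sum_(x < n) (n - d <= x) + \sum_(x < n) (x < n - d) = n)%N.
    rewrite -big_split /= (eq_bigr (fun=> 1%N)) ?sum1_card ?card_ord // => x _.
    by case: ltnP.
  by move: h; rewrite sum_ltn_ord; lia.
have hlo n : (\sum_(x < n) (x < d) <= d)%N by rewrite sum_ltn_ord; lia.
apply: (@leq_trans (\sum_(y < j2) (2 * d + (j2 - d <= y) * j1))).
  apply: leq_sum => y _; rewrite !big_split /= sum_nat_const card_ord.
  by rewrite (mulnC j1) leq_add2r mul2n -addnn (leq_add (hlo j1) (hi j1)).
rewrite big_split /= sum_nat_const card_ord -big_distrl /=.
by rewrite (mulnC j2) leq_add2l leq_mul2r hi orbT.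
Qed.

Lemma entropy_bound (e j1 j2 : nat) : (0 < j1)%N -> (0 < j2)%N ->
  `|ln #|language hard_square_shift (rectangle j1 j2)|%:R / (j1 * j2)%:R +
    ln (root_value R (2 * e))| <=
  (9/10) ^+ e + (4 * e%:R / j1%:R + 2 * e%:R / j2%:R).
Proof.
move=> h1 h2; rewrite card_language ln_partition_function.
set F := ln (root_value R (2 * e)); set K : R := (9/10) ^+ e.
have p1 : (0 : R) < j1%:R by rewrite ltr0n.
have p2 : (0 : R) < j2%:R by rewrite ltr0n.
have pm : (0 : R) < (j1 * j2)%:R by rewrite ltr0n muln_gt0 h1.
rewrite -(ler_pM2r pm) -[X in _ * X <= _](gtr0_norm pm) -normrM mulrDl divfK ?gt_eqF //.
have -> : F * (j1 * j2)%:R = \sum_(y < j2) \sum_(x < j1) F.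
  by rewrite !sumr_const !card_ord -mulrnA mulr_natr.
rewrite -big_split /=.
under eq_bigr do rewrite -big_split /=.
apply: le_trans (ler_norm_sum _ _ _) _.
apply: le_trans (_ : \sum_(y < j2) \sum_(x < j1) (K +
    ((x < 2 * e) + (j1 - 2 * e <= x) + (j2 - 2 * e <= y))%N%:R) <= _).
  apply: ler_sum => y _; apply: le_trans (ler_norm_sum _ _ _) _.
  by apply: ler_sum => x _; exact: vacancy_near.
under eq_bigr do rewrite big_split /= -natr_sum.
rewrite big_split /= -natr_sum !sumr_const !card_ord -mulrnA mulrDl.
rewrite -(mulr_natr K) lerD2l.
have := boundary_count (2 * e) j1 j2; rewrite -(ler_nat R) => /le_trans; apply.
rewrite le_eqVlt; apply/orP; left; apply/eqP; rewrite !natrD !natrM.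
by field; rewrite !gt_eqF.
Qed.

(** The bound on rectangles holds for every depth, with a boundary term that vanishes as both sides
    grow. Taking the depth large makes the quotients Cauchy; the limit then satisfies the bound for
    the given [e]. *)
Lemma topological_entropy_near (e : nat) :
  `|topological_entropy R hard_square_shift + ln (root_value R (2 * e))| <= (9/10) ^+ e.
Proof.
pose f (j : nat * nat) : R :=
  ln #|language hard_square_shift (rectangle j.1 j.2)|%:R / (j.1 * j.2)%:R.
have near_f k (eps : R) : 0 < eps ->
    \forall j \near filter_prod \oo \oo,
      `|f j + ln (root_value R (2 * k))| <= (9/10) ^+ k + eps.
  (* Each quotient [k / j] has to be at most [eps / 6], because the boundary terms carry the weights
     4 and 2. *)
  move=> eps0; pose N := (Num.truncn (6 * k%:R / eps)).+1.
  have hN : 6 * k%:R / eps < N%:R by exact: truncnS_gt.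
  exists ([set j | (N <= j)%N], [set j | (N <= j)%N]).
    by split; exists N.
  move=> [j1 j2] [/= hj1 hj2].
  have N0 : (0 < N)%N by [].
  apply: le_trans (entropy_bound k (leq_trans N0 hj1) (leq_trans N0 hj2)) _.
  rewrite lerD2l.
  have hb j : (N <= j)%N -> k%:R / j%:R <= eps / 6.
    move=> hj; have j0 : (0 : R) < j%:R by rewrite ltr0n (leq_trans N0 hj).
    rewrite ler_pdivrMr // -ler_pdivrMl ?divr_gt0 // invf_div.
    have : N%:R <= j%:R :> R by rewrite ler_nat.
    by move: hN; rewrite mulrAC; lra.
  by have := hb _ hj1; have := hb _ hj2; rewrite -!mulrA; lra.
have small (eps : R) : 0 < eps -> exists k, (9/10) ^+ k < eps.
  move=> eps0; have /cvgrPdist_lt/(_ _ eps0) : (fun k => (9/10 : R) ^+ k) @ \oo --> (0 : R).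
    by apply: cvg_expr; rewrite gtr0_norm; lra.
  case=> k _ /(_ k (leqnn k)); rewrite sub0r normrN ger0_norm ?exprn_ge0 // => h.
  by exists k.
have cf : cvg (f @ filter_prod \oo \oo).
  apply/cauchy_cvgP/cauchy_exP => eps eps0.
  have [k hk] := small (eps / 2) ltac:(lra).
  exists (- ln (root_value R (2 * k))).
  have := near_f k (eps / 4) ltac:(lra); apply: filterS => j hj.
  by rewrite /ball /= -opprD normrN addrC; lra.
have lf : f @ filter_prod \oo \oo --> topological_entropy R hard_square_shift by exact: cf.
set h := topological_entropy _ _ in lf *.
rewrite leNgt; apply/negP => hlt.
pose eps := (`|h + ln (root_value R (2 * e))| - (9/10) ^+ e) / 3.
have eps0 : 0 < eps by rewrite /eps; lra.
have h1 : \forall j \near filter_prod \oo \oo, `|h - f j| < eps.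
  by have /cvgrPdist_lt/(_ _ eps0) := lf.
have h2 : \forall j \near filter_prod \oo \oo, `|h - f j| < eps /\
    `|f j + ln (root_value R (2 * e))| <= (9/10) ^+ e + eps.
  by apply: filterI => //; exact: near_f.
have [j [hj1 hj2]] := filter_ex h2.
have := ler_normD (h - f j) (f j + ln (root_value R (2 * e))).
by rewrite addrA subrK; rewrite /eps in hj1 hj2 *; lra.
Qed.

End Entropy.

(** * The algorithm *)

Local Close Scope classical_set_scope.
Local Open Scope nat_scope.

(** A node is coded by the base-4 number whose digits after a leading 1 spell its path: the root is
    1, and [i] has the children [4 * i + j]. The guard [4 <= _] excludes the leading digit, so for a
    path this counts the steps in direction [q]; no number [i] has more than [i] such digits. *)
Definition steps (q i : nat) : nat :=
  \sum_(t < i) ((4 <= i %/ 4 ^ t) && ((i %/ 4 ^ t) %% 4 == q)).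

(* [q = 4] compares the two sites themselves. *)
Definition same_site (i j q : nat) : bool :=
  (steps 0 i + steps 2 j + (q == 2) == steps 0 j + steps 2 i + (q == 0)) &&
  (steps 1 i + steps 3 j + (q == 3) == steps 1 j + steps 3 i + (q == 1)).

Definition in_past (i : nat) : bool :=
  (steps 1 i < steps 3 i) || ((steps 1 i == steps 3 i) && (steps 0 i < steps 2 i)).

(** The path leaves the ancestor [i %/ 4 ^ t.+1] in direction [(i %/ 4 ^ t) %% 4], so the cut made
    there removes the site of that ancestor and its neighbours in smaller directions. *)
Definition removed_at (i t : nat) : bool :=
  same_site i (i %/ 4 ^ t.+1) 4 ||
  has (same_site i (i %/ 4 ^ t.+1)) (iota 0 ((i %/ 4 ^ t) %% 4)).

Definition blocked (i : nat) : bool :=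
  in_past i || has (fun t => (4 <= i %/ 4 ^ t) && removed_at i t) (iota 0 i).

Definition pow_log (n : nat) : nat := 2 ^ trunc_log 2 n.
(* Two levels contract by 9/10 and (9/10)^7 < 1/2, so 14 levels, a factor 4^14 = 2^28 in the
   number of leaves, are spent per binary digit of precision. *)
Definition leaf_index (n : nat) : nat := (8 * pow_log n) ^ 28.
(** With [B = 2 * pow_log n > n], the accumulated rounding error, less than
    [leaf_index n / scale n], is below [1 / (16 * B)]. *)
Definition scale (n : nat) : nat := 16 * (2 * pow_log n) * leaf_index n.
Definition table_length (n : nat) : nat := 2 * leaf_index n.

(* The table is built downwards, so that entry [4 * i + j] sits at distance [3 * i + j - 1]. *)
Definition child_value (a : seq nat) (i j : nat) : nat := nth 0 a (3 * i + j - 1).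

(** An entry [c] stands for [c / scale n]. Clearing denominators in [scale n / (1 + product)] gives
    the fifth and fourth powers, and a single division rounds once per node. *)
Definition table_entry (x : nat * seq nat * nat) : nat :=
  let: (n, a, i) := x in
  if (leaf_index n <= i) || blocked i then scale n
  else scale n ^ 5 %/ (scale n ^ 4 + child_value a i 0 * child_value a i 1 *
                                      child_value a i 2 * child_value a i 3).

(** Entry 1 is the root. With the common denominator [scale ^ 2], each of the at most [scale] terms
    loses at most [1 / scale ^ 2] by rounding. *)
Definition entropy_num (x : nat * seq nat) : nat :=
  \sum_(k < scale x.1) (if nth 0 x.2 1 <= k then scale x.1 ^ 2 %/ k else 0).

Definition entropy_den (x : nat * seq nat) : nat := scale x.1 ^ 2.

Section PolytimePaths.
Variable C : context.
Implicit Types f g h : C -> nat.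

Lemma polytime_steps q f : polytime C f -> polytime C (fun x => steps q (f x)).
Proof.
move=> hf.
apply: (polytime_sum (F := fun x t => (4 <= f x %/ 4 ^ t) && ((f x %/ 4 ^ t) %% 4 == q)) hf).
have hd := polytime_divexp 4 (polytime_weaken hf) (polytime_last C).
have hc c := polytime_const (extend C) c.
exact: polytime_andb (polytime_leq (hc 4) hd) (polytime_eq (polytime_mod hd (hc 4)) (hc q)).
Qed.

End PolytimePaths.

Section PolytimeEntry.
Variable C : context.
Implicit Types f g h : C -> nat.

Lemma polytime_same_site f g h : polytime C f -> polytime C g -> polytime C h ->
  polytime C (fun x => same_site (f x) (g x) (h x)).
Proof.
move=> hf hg hh.
have hs q := polytime_steps q hf; have ht q := polytime_steps q hg.
have he q := polytime_eq hh (polytime_const C q).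
apply: polytime_andb; apply: polytime_eq; apply: polytime_add (he _); exact: polytime_add.
Qed.

Lemma polytime_in_past f : polytime C f -> polytime C (fun x => in_past (f x)).
Proof.
move=> hf; have hs q := polytime_steps q hf.
apply: polytime_orb; first exact: polytime_leq (polytime_succ (hs 1)) (hs 3).
exact: polytime_andb (polytime_eq (hs 1) (hs 3)) (polytime_leq (polytime_succ (hs 0)) (hs 2)).
Qed.

End PolytimeEntry.

Lemma polytime_removed_at (C : context) (f g : C -> nat) : polytime C f -> polytime C g ->
  polytime C (fun x => removed_at (f x) (g x)).
Proof.
move=> hf hg; have hd := polytime_divexp 4 hf (polytime_succ hg).
apply: polytime_orb; first exact: polytime_same_site hf hd (polytime_const C 4).
apply: (polytime_has (F := fun x => same_site (f x) (f x %/ 4 ^ (g x).+1))).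
  exact: polytime_mod (polytime_divexp 4 hf hg) (polytime_const C 4).
exact: polytime_same_site (polytime_weaken hf) (polytime_weaken hd) (polytime_last C).
Qed.

Lemma polytime_blocked (C : context) (f : C -> nat) :
  polytime C f -> polytime C (fun x => blocked (f x)).
Proof.
move=> hf; apply: polytime_orb; first exact: polytime_in_past.
apply: (polytime_has (F := fun x t => (4 <= f x %/ 4 ^ t) && removed_at (f x) t)) => //.
have hfw := polytime_weaken hf; have hl := polytime_last C.
apply: polytime_andb; last exact: polytime_removed_at.
exact: polytime_leq (polytime_const _ 4) (polytime_divexp 4 hfw hl).
Qed.

Lemma pow_log_le (n : nat) : pow_log n <= n.+1.
Proof.
by case: n => [|n]; rewrite /pow_log ?trunc_log0 //; apply: leqW; apply: trunc_logP.
Qed.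

Lemma polytime_pow_log (C : context) (f : C -> nat) :
  polytime C f -> polytime C (fun x => pow_log (f x)).
Proof.
move=> hf; apply: polytime_exp => //; last exact: polytime_trunc_log2.
apply: poly_bounded_le (poly_bounded_succ hf.1) => x; exact: pow_log_le.
Qed.

Lemma polytime_leaf_index (C : context) (f : C -> nat) :
  polytime C f -> polytime C (fun x => leaf_index (f x)).
Proof.
move=> hf; apply: polytime_expn.
exact: polytime_mul (polytime_const C 8) (polytime_pow_log hf).
Qed.

Lemma polytime_scale (C : context) (f : C -> nat) :
  polytime C f -> polytime C (fun x => scale (f x)).
Proof.
move=> hf; apply: polytime_mul (polytime_leaf_index hf).
apply: polytime_mul (polytime_const C 16) _.
exact: polytime_mul (polytime_const C 2) (polytime_pow_log hf).
Qed.

Lemma polytime_run_input : polytime run_context (fun x => x.1).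
Proof.
have hb : poly_bounded run_context (fun x => x.1).
  by exists 1 => -[n a]; rewrite /context_size expn1 /=; lia.
split=> //; exists (fun pos b => copy (last 0 pos) b b.+1), (fun x => 10 * x.1 + 2).
  apply: poly_bounded_add (poly_bounded_const _ 2).
  exact: poly_bounded_mul (poly_bounded_const _ 10) hb.
move=> [n a] [|k [|k' pos]] env tin tout //= [hk] /andP[hs _].
rewrite -upd_end -hk; apply: runs_copy; rewrite ?nth_default //; apply/eqP; lia.
Qed.

Lemma polytime_entry : polytime (extend run_context) table_entry.
Proof.
have hi := polytime_last run_context.
have hn := polytime_weaken polytime_run_input.
have hM := polytime_scale hn.
have hc j : polytime (extend run_context) (fun x => child_value x.1.2 x.2 j).
  apply: (polytime_table (C := extend run_context) (f := fun x => 3 * x.2 + j - 1)).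
  apply: polytime_sub (polytime_const _ 1); apply: polytime_add (polytime_const _ j).
  exact: polytime_mul (polytime_const _ 3) hi.
apply: (@polytime_ext _ (fun x : extend run_context =>
  if (leaf_index x.1.1 <= x.2) || blocked x.2 then scale x.1.1
  else scale x.1.1 ^ 5 %/ (scale x.1.1 ^ 4 +
    child_value x.1.2 x.2 0 * child_value x.1.2 x.2 1 *
    child_value x.1.2 x.2 2 * child_value x.1.2 x.2 3))) => [[[n a] i] //|].
apply: polytime_if => //.
  apply: polytime_orb; last exact: polytime_blocked.
  exact: polytime_leq (polytime_leaf_index hn) hi.
apply: polytime_div; first exact: polytime_expn.
apply: polytime_add; first exact: polytime_expn.
by do 3! apply: polytime_mul => //.
Qed.

Lemma polytime_num : polytime run_context entropy_num.
Proof.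
have hn := polytime_run_input; have hM := polytime_scale hn.
apply: (@polytime_sum run_context (fun x => scale x.1)
  (fun x k => if nth 0 x.2 1 <= k then scale x.1 ^ 2 %/ k else 0)) => //.
apply: polytime_if (polytime_const _ 0).
  apply: polytime_leq (polytime_last _).
  exact: (polytime_weaken (polytime_table (C := run_context) (polytime_const _ 1))).
exact: polytime_div (polytime_expn 2 (polytime_weaken hM)) (polytime_last _).
Qed.

Lemma polytime_den : polytime run_context entropy_den.
Proof. exact: polytime_expn (polytime_scale polytime_run_input). Qed.

Lemma poly_bounded_input (f : nat -> nat) :
  polytime run_context (fun x => f x.1) -> poly_bounded input_context f.
Proof.
move=> [[k hk] _]; exists k => n; have := hk (n, [::]).
by rewrite /context_size /= !addn0.
Qed.

Lemma table_entry_le (n : nat) (a : seq nat) (i : nat) : table_entry (n, a, i) <= scale n.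
Proof.
rewrite /table_entry; case: ifP => // _.
case: (posnP (scale n)) => [->|h]; first by rewrite exp0n // div0n.
have h4 : 0 < scale n ^ 4 by rewrite expn_gt0 h.
have e : scale n = scale n ^ 5 %/ scale n ^ 4 by rewrite expnS mulnK.
by rewrite [leqRHS]e; apply: leq_div2l => //; exact: leq_addr.
Qed.

(** * Table indices as paths in the tree *)

Definition at_level (k i : nat) : bool := 4 ^ k <= i < 2 * 4 ^ k.

(** The arguments on which [tree_value] is called at the end of the path coded by [i]; the
    arithmetic predicates are checked against it. *)
Fixpoint node (k i : nat) : pred site * site :=
  if k is k'.+1 then
    let x := node k' (i %/ 4) in (cut_region x.1 x.2 (i %% 4), neighbour x.2 (i %% 4))
  else (root_region, (0, 0)%R).

Lemma at_level_div (k i : nat) : at_level k.+1 i -> at_level k (i %/ 4).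
Proof. by rewrite /at_level !expnS; lia. Qed.

Lemma at_level_gt0 (k i : nat) : at_level k i -> 0 < i.
Proof. by move=> /andP[h _]; apply: leq_trans h; rewrite expn_gt0. Qed.

Lemma at_level_child (k i j : nat) : at_level k i -> j < 4 -> at_level k.+1 (4 * i + j).
Proof. by rewrite /at_level !expnS; lia. Qed.

Lemma div_exp4_small (i t : nat) : i <= t -> i %/ 4 ^ t = 0.
Proof. by move=> h; apply: divn_small; apply: leq_ltn_trans h (ltn_expl _ _). Qed.

Lemma steps_rec (q i : nat) : 4 <= i -> steps q i = steps q (i %/ 4) + (i %% 4 == q).
Proof.
move=> hi; rewrite /steps; case: i hi => // i hi.
rewrite big_ord_recl divn1 hi andTb addnC; congr (_ + _).
rewrite (eq_bigr (fun t : 'I_i => nat_of_bool ((4 <= i.+1 %/ 4 %/ 4 ^ t) &&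
    ((i.+1 %/ 4 %/ 4 ^ t) %% 4 == q)))); last first.
  by move=> t _; rewrite lift0 expnS divnMA.
set m := i.+1 %/ 4; have hm : m <= i by rewrite /m; lia.
rewrite -(@big_mkord _ _ _ i xpredT (fun t => (4 <= m %/ 4 ^ t) && ((m %/ 4 ^ t) %% 4 == q) : nat)).
rewrite (big_cat_nat (n := m)) //= big_mkord -[RHS]addn0; congr (_ + _).
rewrite big_nat_cond big1 // => t /andP[/andP[h _] _].
by rewrite div_exp4_small.
Qed.

Definition path_site (i : nat) : site :=
  (Posz (steps 0 i) - Posz (steps 2 i), Posz (steps 1 i) - Posz (steps 3 i))%R.

Lemma node_site (k i : nat) : at_level k i -> (node k i).2 = path_site i.
Proof.
elim: k i => [|k IH] i hi /=.
  have -> : i = 1 by move: hi; rewrite /at_level expn0; lia.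
  by rewrite /path_site /steps !big_ord_recl !big_ord0.
rewrite IH; last exact: at_level_div.
have h4 : 4 <= i.
  by case/andP: hi => h _; apply: leq_trans h; rewrite expnS leq_pmulr // expn_gt0.
rewrite /path_site !(steps_rec _ h4).
have : i %% 4 < 4 by rewrite ltn_mod.
by case: (i %% 4) => [|[|[|[|m]]]] //= _; rewrite ?addn0 ?addn1; congr pair; lia.
Qed.

Lemma same_siteE (i j q : nat) : q < 4 ->
  same_site i j q = (path_site i == neighbour (path_site j) q).
Proof.
rewrite /same_site /path_site; case: q => [|[|[|[|q]]]] //= _; rewrite xpair_eqE.
all: by apply/idP/idP => /andP[h1 h2]; apply/andP; split; lia.
Qed.

Lemma same_site4E (i j : nat) : same_site i j 4 = (path_site i == path_site j).
Proof.
rewrite /same_site /path_site xpair_eqE /=.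
by apply/idP/idP => /andP[h1 h2]; apply/andP; split; lia.
Qed.

Lemma removed_atE (i t : nat) :
  removed_at i t = ~~ avoids (path_site (i %/ 4 ^ t.+1)) ((i %/ 4 ^ t) %% 4) (path_site i).
Proof.
rewrite /removed_at /avoids negb_and negbK same_site4E; congr (_ || _).
rewrite -has_predC; apply: eq_in_has => q /=; rewrite mem_iota add0n /= => hq.
by rewrite negbK same_siteE //; apply: ltn_trans hq _; rewrite ltn_mod.
Qed.

Lemma in_pastE (i : nat) : in_past i = ~~ root_region (path_site i).
Proof.
rewrite /in_past /root_region /path_site /=.
by apply/idP/idP; lia.
Qed.

(** Unrolls the cuts along the path, with [t] counting generations upwards from the node, as in
    [removed_at]. *)
Lemma node_region (k i : nat) (u : site) :
  (node k i).1 u = root_region u &&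
    all (fun t => avoids (node (k - t.+1) (i %/ 4 ^ t.+1)).2 ((i %/ 4 ^ t) %% 4) u) (iota 0 k).
Proof.
elim: k i => [|k IH] i /=; first by rewrite andbT.
rewrite /cut_region IH -andbA subn1 /= expn1 expn0 divn1; congr (_ && _).
rewrite andbC; congr (_ && _); rewrite -[1]/(1 + 0) iotaDl all_map.
by apply: eq_all => t /=; rewrite add1n subSS -divnMA -expnS -divnMA -expnS.
Qed.

Lemma at_level_iter (k t i : nat) : at_level k i -> t <= k -> at_level (k - t) (i %/ 4 ^ t).
Proof.
move=> hi; elim: t => [|t IH] ht; first by rewrite subn0 divn1.
rewrite expnSr divnMA; apply: at_level_div.
by rewrite -subSn // subSS; apply: IH; exact: ltnW.
Qed.

Lemma at_level_ge4 (k t i : nat) : at_level k i -> (4 <= i %/ 4 ^ t) = (t < k).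
Proof.
move=> hi; case: (ltnP t k) => h.
  have /andP[h1 _] := at_level_iter hi (ltnW h).
  apply: leq_trans h1.
  by case e : (k - t) => [|m]; [lia|rewrite expnS leq_pmulr // expn_gt0].
apply/negbTE; rewrite -ltnNge ltn_divLR ?expn_gt0 //.
case/andP: hi => _ h2; apply: leq_trans h2 _.
have : 4 ^ k <= 4 ^ t by rewrite leq_pexp2l.
by move=> h3; lia.
Qed.

Lemma blockedE (k i : nat) : at_level k i -> blocked i = ~~ (node k i).1 (node k i).2.
Proof.
move=> hi; rewrite node_region node_site // negb_and -in_pastE /blocked; congr (_ || _).
rewrite -has_predC.
have hk : k <= i by case/andP: hi => h _; apply: leq_trans h; apply/ltnW/ltn_expl.
have hpt t : t < k -> removed_at i t =
    ~~ avoids (node (k - t.+1) (i %/ 4 ^ t.+1)).2 ((i %/ 4 ^ t) %% 4) (path_site i).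
  by move=> ht; rewrite removed_atE node_site //; apply: at_level_iter.
apply/hasP/hasP => -[t]; rewrite mem_iota add0n /= => ht.
  move=> /andP[h4 hr]; rewrite (at_level_ge4 _ hi) in h4.
  by exists t; rewrite ?mem_iota //= -hpt.
rewrite -hpt // => hr; exists t; first by rewrite mem_iota add0n; lia.
by rewrite (at_level_ge4 _ hi) ht.
Qed.

Local Open Scope ring_scope.

(** The 3 extra binary digits bring the truncation error down to [1 / (8 * pow_log n)], a quarter of
    [1 / B] for [B = 2 * pow_log n]. *)
Definition depth (n : nat) : nat := (2 * (7 * (trunc_log 2 n + 3)))%N.

Lemma leaf_indexE (n : nat) : leaf_index n = (4 ^ depth n)%N.
Proof.
rewrite /leaf_index /pow_log /depth -[8%N]/(2 ^ 3)%N -expnD -expnM -[4%N]/(2 ^ 2)%N -expnM.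
by congr (_ ^ _)%N; lia.
Qed.

Lemma leaf_index_gt0 (n : nat) : (0 < leaf_index n)%N.
Proof. by rewrite leaf_indexE expn_gt0. Qed.

Lemma pow_log_gt0 (n : nat) : (0 < pow_log n)%N.
Proof. by rewrite /pow_log expn_gt0. Qed.

Lemma scale_gt0 (n : nat) : (0 < scale n)%N.
Proof. by rewrite /scale muln_gt0 leaf_index_gt0 andbT muln_gt0 /= muln_gt0 pow_log_gt0. Qed.

Local Notation table := (build_table table_length table_entry).

Definition table_value (n i : nat) : nat := nth 0%N (table n 0) i.

Lemma build_table_drop (n m : nat) : (m <= table_length n)%N ->
  table n m = drop m (table n 0).
Proof.
elim: m => [|m IH] hm; first by rewrite drop0.
by rewrite -[in RHS]add1n -drop_drop -IH ?(ltnW hm) // [in RHS]build_tableS //= drop0.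
Qed.

Lemma table_valueE (n i : nat) : (i < table_length n)%N ->
  table_value n i = table_entry (n, table n i.+1, i).
Proof.
move=> hi; rewrite /table_value -[i in LHS]addn0 -nth_drop -build_table_drop ?(ltnW hi) //.
by rewrite build_tableS.
Qed.

Lemma child_valueE (n i j : nat) : (0 < i < table_length n)%N ->
  child_value (table n i.+1) i j = table_value n (4 * i + j).
Proof.
move=> /andP[h0 hi]; rewrite /child_value build_table_drop // nth_drop /table_value.
by congr (nth _ _ _); lia.
Qed.

Lemma table_value_le (n i : nat) : (table_value n i <= scale n)%N.
Proof.
case: (ltnP i (table_length n)) => hi; first by rewrite table_valueE // table_entry_le.
rewrite /table_value nth_default //; apply: leq_trans hi.
rewrite /build_table subn0; elim: (table_length n) 0%N => //= m IH l.
by rewrite ltnS.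
Qed.

(** * Rounding error of the table *)

Section Error.
Variable R : realType.

Lemma prod_dist (m : nat) (x y : nat -> R) :
  (forall j, 0 <= x j <= 1) -> (forall j, 0 <= y j <= 1) ->
  `|\prod_(j < m) x j - \prod_(j < m) y j| <= \sum_(j < m) `|x j - y j|.
Proof.
move=> hx hy; elim: m => [|m IH]; first by rewrite !big_ord0 subrr normr0.
rewrite !big_ord_recr /=; set P := \prod_(_ < _) _; set Q := \prod_(_ < _) _.
have hP : 0 <= P <= 1.
  rewrite prodr_ge0 /=; last by move=> j _; case/andP: (hx j).
  by apply: prodr_ile1 => j _; exact: hx.
have -> : P * x m - Q * y m = (P - Q) * y m + P * (x m - y m) by ring.
apply: le_trans (ler_normD _ _) _; rewrite !normrM; apply: lerD.
  apply: le_trans IH; apply: ler_piMr => //.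
  by have /andP[h0 h1] := hy m; rewrite ger0_norm.
by apply: ler_piMl => //; case/andP: hP => h0 h1; rewrite ger0_norm.
Qed.

Lemma inv_1D_dist (P Q : R) : 0 <= P -> 0 <= Q -> `|(1 + P)^-1 - (1 + Q)^-1| <= `|P - Q|.
Proof.
move=> hP hQ.
have -> : (1 + P)^-1 - (1 + Q)^-1 = (Q - P) * ((1 + P) * (1 + Q))^-1.
  by field; apply/andP; split; lra.
rewrite normrM distrC; apply: ler_piMr => //.
have h : 1 <= (1 + P) * (1 + Q) by have := mulr_ge0 hP hQ; lra.
by rewrite ger0_norm ?invr_ge0 ?invf_le1; lra.
Qed.

Lemma divn_approx (a b : nat) : (0 < b)%N ->
  a%:R / b%:R - 1 <= ((a %/ b)%N%:R : R) <= a%:R / b%:R.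
Proof.
move=> hb; have b0 : (0 : R) < b%:R by rewrite ltr0n.
apply/andP; split; last first.
  by rewrite ler_pdivlMr // -natrM ler_nat leq_divM.
rewrite lerBlDr ler_pdivrMr // natr1 -natrM ler_nat.
by apply: ltnW; rewrite -ltn_divLR.
Qed.

(** In units of [1 / scale n] the error obeys [E d.+1 = 4 * E d + 1]: on [0, 1] the product is
    1-Lipschitz in each of its four factors, [1 / (1 + P)] is 1-Lipschitz in [P], and the division
    adds at most one unit. *)
Lemma table_error (n d k i : nat) : (k + d)%N = depth n -> at_level k i ->
  `|(table_value n i)%:R / (scale n)%:R - tree_value R d (node k i).1 (node k i).2| <=
  (4 ^+ d - 1) / (scale n)%:R.
Proof.
have M0 : (0 : R) < (scale n)%:R by rewrite ltr0n scale_gt0.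
set M : R := (scale n)%:R in M0 *.
elim: d k i => [|d IH] k i hk hi.
  have hl : (leaf_index n <= i)%N.
    by rewrite leaf_indexE -hk addn0; case/andP: hi.
  have hlt : (i < table_length n)%N.
    by rewrite /table_length leaf_indexE -hk addn0; case/andP: hi.
  by rewrite table_valueE // /table_entry hl /= divff ?gt_eqF // ?subrr normr0 ?expr0 ?subrr mul0r.
have hi0 := at_level_gt0 hi.
have hl : (i < leaf_index n)%N.
  case/andP: hi => _ h; apply: leq_trans h _; rewrite leaf_indexE -hk addnS expnS.
  by apply: leq_mul => //; rewrite leq_pexp2l // leq_addr.
have hlt : (i < table_length n)%N by rewrite /table_length; lia.
have hd : (1 : R) <= 4 ^+ d by rewrite exprn_ege1 // ler1n.
have hrhs : 0 <= (4 ^+ d.+1 - 1) / M.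
  by rewrite divr_ge0 ?(ltW M0) // exprS; lra.
rewrite table_valueE // /table_entry leqNgt hl /= (blockedE hi).
case: ifP => /= [/negbTE ->|/negbFE ->].
  by rewrite divff ?gt_eqF // subrr normr0.
rewrite !child_valueE ?hi0 //.
pose x j : R := (table_value n (4 * i + j))%:R / M.
pose y j : R := tree_value R d (cut_region (node k i).1 (node k i).2 j) (neighbour (node k i).2 j).
have hx j : 0 <= x j <= 1.
  by rewrite divr_ge0 ?ler0n //= ler_pdivrMr // mul1r ler_nat table_value_le.
have hy j : 0 <= y j <= 1.
  have /andP[h0 h1] : 1 / 2 <= y j <= 1 by exact: tree_value_itv.
  by apply/andP; split; lra.
have hxy (j : 'I_4) : `|x j - y j| <= (4 ^+ d - 1) / M.
  have hj := at_level_child hi (ltn_ord j).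
  have := IH k.+1 (4 * i + j)%N _ hj; rewrite addSnnS => /(_ hk) /=.
  have -> : ((4 * i + j) %/ 4 = i)%N by have := ltn_ord j; lia.
  by have -> : ((4 * i + j) %% 4 = j)%N by have := ltn_ord j; lia.
set a := (_ %/ _)%N.
have ha : `|a%:R / M - (1 + \prod_(j < 4) x j)^-1| <= 1 / M.
  pose c j := table_value n (4 * i + j).
  have hden : (0 < scale n ^ 4 + c 0 * c 1 * c 2 * c 3)%N.
    by rewrite addn_gt0 expn_gt0 scale_gt0.
  have hP : 0 <= \prod_(j < 4) x j by apply: prodr_ge0 => j _; case/andP: (hx j).
  have e : ((scale n ^ 5)%N)%:R / ((scale n ^ 4 + c 0 * c 1 * c 2 * c 3)%N)%:R =
      M * (1 + \prod_(j < 4) x j)^-1 :> R.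
    rewrite natrD !natrX -/M !natrM.
    have e1 : \prod_(j < 4) x j = (c 0)%:R * (c 1)%:R * (c 2)%:R * (c 3)%:R / M ^+ 4.
      rewrite !big_ord_recr big_ord0 /= /x /c.
      by field; rewrite gt_eqF.
    rewrite e1 in hP *.
    have h4 : 0 < M ^+ 4 by rewrite exprn_gt0.
    have hC : 0 <= (c 0)%:R * (c 1)%:R * (c 2)%:R * (c 3)%:R :> R by rewrite !mulr_ge0.
    move: (_ * (c 3)%:R) hC => P hC.
    have hMP : 0 < M ^+ 4 + P by lra.
    by field; rewrite !gt_eqF.
  have := divn_approx (scale n ^ 5)%N hden; rewrite e -/a.
  set q := (1 + _)^-1; move=> /andP[h1 h2].
  rewrite -(ler_pM2r M0) -[X in _ * X](gtr0_norm M0) -normrM mulrBl !divfK ?gt_eqF //.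
  by rewrite ler_norml; apply/andP; split; lra.
have hxyp := inv_1D_dist (P := \prod_(j < 4) x j) (Q := \prod_(j < 4) y j).
have hP : 0 <= \prod_(j < 4) x j by apply: prodr_ge0 => j _; case/andP: (hx j).
have hQ : 0 <= \prod_(j < 4) y j by apply: prodr_ge0 => j _; case/andP: (hy j).
have h1 : `|(1 + \prod_(j < 4) x j)^-1 - (1 + \prod_(j < 4) y j)^-1| <= 4 * ((4 ^+ d - 1) / M).
  apply: le_trans (hxyp hP hQ) _; apply: le_trans (prod_dist 4 hx hy) _.
  apply: le_trans (_ : \sum_(j < 4) ((4 ^+ d - 1) / M) <= _).
    by apply: ler_sum => j _; exact: hxy.
  by rewrite sumr_const card_ord mulr_natl.
have h2 : 4 * ((4 ^+ d - 1) / M) + 1 / M <= (4 ^+ d.+1 - 1) / M.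
  by rewrite mulrA -mulrDl ler_wpM2r ?invr_ge0 ?(ltW M0) // exprS; lra.
apply: le_trans h2; rewrite [leRHS]addrC; apply: le_trans (lerD ha h1).
by apply: le_trans (ler_normD _ _); rewrite addrA subrK.
Qed.

End Error.

(** * The logarithm and the total error *)

Section Logarithm.
Variable R : realType.

Lemma ln_step (k : nat) : (0 < k)%N ->
  k.+1%:R^-1 <= (ln k.+1%:R - ln k%:R : R) <= k%:R^-1.
Proof.
move=> hk; have k0 : (0 : R) < k%:R by rewrite ltr0n.
have k1 : (0 : R) < k.+1%:R by rewrite ltr0n.
have e : (k.+1%:R : R) = k%:R + 1 by rewrite natr1.
rewrite -ln_div ?posrE //; apply/andP; split.
  have -> : ln (k.+1%:R / k%:R) = - ln (1 + - k.+1%:R^-1) :> R.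
    rewrite -lnV ?posrE.
      by congr ln; rewrite e; field; rewrite addrK -e !gt_eqF.
    by rewrite subr_gt0 invf_lt1 // ltr1n.
  rewrite lerNr; apply: le_ln1Dx; rewrite ltrN2 invf_lt1 //.
  by rewrite ltr1n.
have -> : k.+1%:R / k%:R = 1 + k%:R^-1 :> R by rewrite e; field; rewrite gt_eqF.
by apply: le_ln1Dx; apply: lt_trans (_ : 0 < _); rewrite ?invr_gt0 // ltrN10.
Qed.

(** A left Riemann sum of the decreasing function [1 / x]: the excess over the integral at step [k]
    is at most [1 / k - 1 / k.+1], which telescopes. *)
Lemma ln_ratio_sum (a m : nat) : (0 < a)%N -> (a <= m)%N ->
  ln m%:R - ln a%:R <= (\sum_(a <= k < m) k%:R^-1 : R) <= ln m%:R - ln a%:R + a%:R^-1 - m%:R^-1.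
Proof.
move=> ha hm.
have hln : \sum_(a <= k < m) (ln k.+1%:R - ln k%:R) = ln m%:R - ln a%:R :> R.
  by rewrite telescope_sumr.
have hinv : \sum_(a <= k < m) (k.+1%:R^-1 - k%:R^-1) = m%:R^-1 - a%:R^-1 :> R.
  by rewrite telescope_sumr.
apply/andP; split.
  rewrite -hln !big_nat; apply: ler_sum => k /andP[hk _].
  by have /andP[] := ln_step (leq_trans ha hk).
rewrite -subr_ge0; have -> : forall s : R, ln m%:R - ln a%:R + a%:R^-1 - m%:R^-1 - s =
    ln m%:R - ln a%:R - (m%:R^-1 - a%:R^-1) - s by move=> s; ring.
rewrite -hln -hinv -!sumrB big_nat; apply: sumr_ge0 => k /andP[hk _].
have /andP[+ _] := ln_step (leq_trans ha hk).
by move: (ln _ - ln _) (k.+1%:R^-1) (k%:R^-1) => l u v ?; lra.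
Qed.

Lemma num_den_approx (n : nat) (t : seq nat) :
  (0 < nth 0%N t 1 <= scale n)%N ->
  `|(entropy_num (n, t))%:R / (entropy_den (n, t))%:R -
    (ln (scale n)%:R - ln (nth 0%N t 1)%:R)| <= (scale n)%:R^-1 + (nth 0%N t 1)%:R^-1 :> R.
Proof.
move=> /andP[ha ham]; rewrite /entropy_num /entropy_den /=.
set a := nth _ _ _ in ha ham *; set m := scale n in ham *.
have hm : (0 < m)%N by exact: leq_trans ha ham.
have m0 : (0 : R) < m%:R by rewrite ltr0n.
have a0 : (0 : R) < a%:R by rewrite ltr0n.
have mi : (0 : R) < m%:R^-1 by rewrite invr_gt0.
have /andP[h1 h2] := ln_ratio_sum ha ham.
have -> : (\sum_(k < m) (if a <= k then m ^ 2 %/ k else 0) = \sum_(a <= k < m) m ^ 2 %/ k)%N.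
  rewrite -(@big_mkord _ _ _ m xpredT (fun k => if a <= k then m ^ 2 %/ k else 0)%N).
  rewrite (big_cat_nat (n := a)) //= big_nat big1 ?add0n => [|k /andP[_ hk]]; last first.
    by rewrite leqNgt hk.
  by rewrite !big_nat; apply: eq_bigr => k /andP[-> _].
have hsum : `|(\sum_(a <= k < m) m ^ 2 %/ k)%N%:R / (m ^ 2)%N%:R - \sum_(a <= k < m) k%:R^-1|
    <= m%:R^-1 :> R.
  rewrite natr_sum mulr_suml -sumrB.
  apply: le_trans (ler_norm_sum _ _ _) _.
  apply: (@le_trans _ _ (\sum_(a <= k < m) (m%:R ^+ 2)^-1)).
    rewrite big_nat [leRHS]big_nat; apply: ler_sum => k /andP[hk _].
    have k0 : (0 < k)%N := leq_trans ha hk.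
    have kr : (0 : R) < k%:R by rewrite ltr0n.
    have /andP[h3 h4] := divn_approx R (m ^ 2)%N k0.
    rewrite natrX in h3 h4 *; set q : R := ((m ^ 2 %/ k)%N)%:R in h3 h4 *.
    have m2 : (0 : R) < m%:R ^+ 2 by rewrite exprn_gt0.
    have -> : q / m%:R ^+ 2 - k%:R^-1 = (q - m%:R ^+ 2 / k%:R) / m%:R ^+ 2.
      by field; rewrite !gt_eqF.
    rewrite normrM [X in _ * X]ger0_norm ?invr_ge0 ?(ltW m2) //.
    rewrite -[leRHS]mul1r; apply: ler_wpM2r; first by rewrite invr_ge0 ltW.
    by rewrite ler_norml; apply/andP; split; lra.
  rewrite sumr_const_nat -[_ *+ (m - a)]mulr_natl.
  apply: (@le_trans _ _ (m%:R / m%:R ^+ 2)).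
    by apply: ler_wpM2r; rewrite ?invr_ge0 ?exprn_ge0 ?(ltW m0) // ler_nat leq_subr.
  by rewrite expr2 invfM mulrA divff ?mul1r // gt_eqF.
have hnorm : forall u v w : R, `|u - w| <= `|u - v| + `|v - w|.
  by move=> u v w; have := ler_normD (u - v) (v - w); rewrite addrA subrK.
apply: le_trans (hnorm _ _ _) _; apply: lerD hsum _.
by rewrite ler_norml; apply/andP; split; lra.
Qed.

(** In units of [1 / B] with [B > n], the truncation of the tree costs at most 8/32, the rounding in
    the table 5/32 after taking logarithms, and the approximate logarithm 7/32. *)
Lemma entropy_num_den_close (n : nat) : (0 < n)%N ->
  let x := (n, build_table table_length table_entry n 0) in
  `|(entropy_num x)%:R / (entropy_den x)%:R - topological_entropy R hard_square_shift|
    < n%:R^-1.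
Proof.
move=> hn /=; set x := (n, _); set h := topological_entropy _ _.
pose B : R := (2 * pow_log n)%:R.
have hB : (n < 2 * pow_log n)%N.
  by rewrite /pow_log -expnS; apply: trunc_log_ltn.
have n0 : (0 : R) < n%:R by rewrite ltr0n.
have B0 : 0 < B by rewrite ltr0n (leq_ltn_trans _ hB).
have Bi : B^-1 < n%:R^-1 by rewrite ltf_pV2 ?posrE // ltr_nat.
have Bi0 : 0 < B^-1 by rewrite invr_gt0.
pose M : R := (scale n)%:R.
have M0 : 0 < M by rewrite ltr0n scale_gt0.
have NE : (leaf_index n)%:R = (4 : R) ^+ depth n by rewrite leaf_indexE natrX.
have N1 : (1 : R) <= 4 ^+ depth n by rewrite exprn_ege1 // ler1n.
have ME : M = 16 * B * 4 ^+ depth n.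
  by rewrite /M /scale natrM natrM NE -/B.
have hMN : (4 ^+ depth n) / M = B^-1 / 16.
  by rewrite ME; field; rewrite !gt_eqF //; lra.
have hMi : M^-1 <= B^-1 / 16.
  by rewrite -hMN -[leLHS]mul1r; apply: ler_wpM2r; rewrite ?invr_ge0 ?(ltW M0).
have hl : at_level 0 1 by [].
pose a := table_value n 1; pose F := root_value R (depth n).
have herr : `|a%:R / M - F| <= (4 ^+ depth n - 1) / M := table_error R (add0n _) hl.
have B1 : B^-1 <= 1 / 2.
  have hB2 : 2 <= B by rewrite /B ler_nat leq_pmulr // pow_log_gt0.
  by rewrite div1r lef_pV2 ?posrE.
have herr' : `|a%:R / M - F| <= B^-1 / 16.
  apply: le_trans herr _; rewrite -hMN; apply: ler_wpM2r; first by rewrite invr_ge0 ltW.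
  lra.
have /andP[F0 F1] : 1 / 2 <= F <= 1 := root_value_itv R (depth n).
move: herr'; rewrite ler_norml => /andP[e1 e2].
(* [F] is at least 1/2 and the error at most 1/32. The inverse 5/2 converts absolute errors into
   ratios and bounds [1 / a] by a multiple of [1 / M]. *)
have ha : 2 / 5 <= a%:R / M by lra.
have a0 : (0 : R) < a%:R.
  by have := @ltr_pM2r _ _ (_ : 0 < M^-1) 0 a%:R; rewrite mul0r invr_gt0 => <- //; lra.
have an0 : (0 < a <= scale n)%N by rewrite -(ltr0n R) a0 table_value_le.
have hnd := num_den_approx an0.
have hai : a%:R^-1 <= 5 / 2 * M^-1.
  have -> : 5 / 2 * M^-1 = (2 / 5 * M)^-1 by field; rewrite gt_eqF.
  have := ha; rewrite ler_pdivlMr // => ha'.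
  by rewrite lef_pV2 ?posrE // mulr_gt0 // divr_gt0.
have hclose : ratio_close (5 / 2 * (B^-1 / 16)) (a%:R / M) F.
  have f1 : B^-1 / 16 <= 2 * (B^-1 / 16) * F.
    by have := mulr_ge0 (ltW Bi0) (_ : 0 <= F - 1 / 2); rewrite subr_ge0 => /(_ F0); lra.
  have f2 : B^-1 / 16 <= 5 / 2 * (B^-1 / 16) * (a%:R / M).
    by have := mulr_ge0 (ltW Bi0) (_ : 0 <= a%:R / M - 2 / 5); rewrite subr_ge0 => /(_ ha); lra.
  have f3 : 0 <= B^-1 / 16 * F by rewrite mulr_ge0 ?divr_ge0 ?(ltW Bi0) //; lra.
  by apply/andP; split; lra.
have hln := close_ln (_ : 0 <= _) (_ : 0 < _) (_ : 0 < _) hclose.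
have {hln} : `|ln (a%:R / M) - ln F| <= 5 / 2 * (B^-1 / 16).
  by apply: hln; lra.
rewrite ln_div ?posrE // => hln.
have hent := topological_entropy_near R (7 * (trunc_log 2 n + 3)).
rewrite -/h -/(depth n) -/F in hent.
have hk : (9/10 : R) ^+ (7 * (trunc_log 2 n + 3)) <= B^-1 / 4.
  rewrite exprM; apply: (@le_trans _ _ ((1 / 2) ^+ (trunc_log 2 n + 3))).
    have h7 : (9/10 : R) ^+ 7 <= 1 / 2 by lra.
    by apply: lerXn2r h7; rewrite nnegrE // exprn_ge0.
  rewrite /B /pow_log natrM natrX div1r exprVn exprD.
  have : (0 : R) < 2 ^+ trunc_log 2 n by rewrite exprn_gt0.
  move: (2 ^+ trunc_log 2 n) => p hp.
  by rewrite le_eqVlt; apply/orP; left; apply/eqP; field; rewrite gt_eqF.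
move: hnd; rewrite -/M; set r := _ / _ => hnd.
move: hnd hln hent; rewrite !ler_norml => /andP[? ?] /andP[? ?] /andP[? ?].
by rewrite ltr_norml; apply/andP; split; lra.
Qed.

End Logarithm.

Theorem theorem15 (R : realType) :
  exists p : {poly R},
    computable_in_time (topological_entropy R hard_square_shift)
      (fun n : nat => p.[n%:R]).
Proof.
have hlen : poly_bounded input_context table_length.
  apply: poly_bounded_input; apply: polytime_mul (polytime_const _ 2) _.
  exact: polytime_leaf_index polytime_run_input.
have hlen' : polytime run_context (fun x => table_length x.1).
  apply: polytime_mul (polytime_const _ 2) _.
  exact: polytime_leaf_index polytime_run_input.
have hscale : poly_bounded input_context scale.
  by apply: poly_bounded_input; exact: polytime_scale polytime_run_input.
have [M [k hM]] := table_machine hlen' hlen polytime_entry hscale table_entry_le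
  polytime_num polytime_den.
exists (('X + 2%:P) ^+ k), M => n hn.
have [t ht hout] := hM n.
set x := (n, _) in hout.
exists (entropy_num x), (entropy_den x); split.
- by rewrite eqz_nat -lt0n /entropy_den expn_gt0 scale_gt0.
- exact: entropy_num_den_close.
- exists t; last exact: hout.
  by rewrite horner_exp hornerD hornerX hornerC -natrD -natrX ltr_nat.
Qed.
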